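(* Let $-1<a<0$ be fixed. There is a positive constant $\Theta$ such that, as $x\to\infty$, $$L(x;\mathrm{id}_{1+a})=\frac{\zeta(1-a)}{\zeta(2)}x\log x-\frac{2\zeta(1-a)}{\zeta(2)}x+\frac{\zeta(1+a)}{(1+a)\zeta(2+a)}x^{1+a}\log x-\frac{1}{(1+a)\zeta(2+a)}\left(\frac{(2+a)\zeta(1+a)}{1+a}+\frac{\zeta'(2+a)}{2}-\Theta\zeta(3+a)\right)x^{1+a}+\frac{\log\sqrt{2\pi}}{1+a}x^{1+a}+\sum_{n\le x}\frac{\mu(n)}{n}\Delta_a\!\left(\frac{x}{n}\right)\log\frac{x}{e}+O_a(\log x),$$ and $$L(x;\phi_{1+a})=\frac{\zeta(1-a)}{\zeta^2(2)}x\log x-\frac{2\zeta(1-a)}{\zeta^2(2)}x+\frac{\zeta(1+a)}{(1+a)\zeta^2(2+a)}x^{1+a}\log x-\frac{1}{(1+a)\zeta^2(2+a)}\left(\frac{(2+a)\zeta(1+a)}{1+a}+\frac{\zeta'(2+a)}{2}-\Theta\zeta(3+a)\right)x^{1+a}+\frac{\log\sqrt{2\pi}}{(1+a)\zeta(2+a)}x^{1+a}+\sum_{n\le x}\frac{(\mu*\mu)(n)}{n}\Delta_a\!\left(\frac{x}{n}\right)\log\frac{x}{e}+O_a\!\left((\log x)^3\right).$$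
   Context: For an arithmetical function $f$ and real $x>1$, $L(x;f):=\sum_{k\le x}\frac1k\sum_{j=1}^{k}f(\gcd(k,j))\log j$. $\mathrm{id}_b(n)=n^b$; $\mu$ is the Möbius function; $(f*g)(n)=\sum_{d\mid n}f(d)g(n/d)$ is the Dirichlet convolution; $\phi_b=\mu*\mathrm{id}_b$ is the Jordan totient function. $\sigma_a(n)=\sum_{d\mid n}d^a$, and $\Delta_a(x)$ is defined by $\sum_{n\le x}\sigma_a(n)=\zeta(1-a)x+\frac{\zeta(1+a)}{1+a}x^{1+a}-\frac{\zeta(-a)}{2}+\Delta_a(x)$. $\zeta$ is the Riemann zeta-function. $O_a$ means the implied constant may depend on $a$. *)

(* Defs.v *)
From HB Require Import structures.
From mathcomp Require Export all_boot all_order all_algebra.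
From mathcomp Require Export all_classical all_reals all_analysis.
Export Order.TTheory GRing.Theory Num.Theory.
Export numFieldNormedType.Exports.

Set Implicit Arguments.
Unset Strict Implicit.
Unset Printing Implicit Defensive.

Local Open Scope classical_set_scope.
Local Open Scope ring_scope.

(* Arithmetical functions are maps nat -> R; their value at 0 is never used. *)
Section ArithmeticalFunctions.
Variable R : realType.
Implicit Types (f g : nat -> R) (a b s x : R) (n : nat).

Definition moebius n : R :=
  if (0 < n)%N && all (fun p => logn p n == 1%N) (primes n)
  then (-1) ^+ size (primes n) else 0.

Definition dirichlet_conv f g n : R :=
  \sum_(d <- divisors n) f d * g (n %/ d)%N.

Definition id_pow b n : R := n%:R `^ b.

Definition jordan b : nat -> R := dirichlet_conv moebius (id_pow b).

Definition sigma a n : R := \sum_(d <- divisors n) d%:R `^ a.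

(* [Num.truncn x] is the integer part of [x] for [0 <= x], so this is the sum
   over the integers 1 <= n <= x. *)
Definition sum_upto x f : R := \sum_(1 <= n < (Num.truncn x).+1) f n.

(* The Riemann zeta-function at real s > 0, s != 1: the Dirichlet series for
   s > 1, and for 0 < s < 1 the value of its analytic continuation in the form
   used by Apostol (Introduction to Analytic Number Theory, section 3.4),
     zeta(s) = lim_(N -> oo) (\sum_(n <= N) n^(-s) - N^(1-s) / (1-s)).
   Other values of s are junk. *)
Definition zeta s : R :=
  if 1 < s then
    limn (fun N => \sum_(1 <= n < N.+1) n%:R `^ (- s))
  else
    limn (fun N => \sum_(1 <= n < N.+1) n%:R `^ (- s)
                   - N%:R `^ (1 - s) / (1 - s)).

Definition Delta a x : R :=
  sum_upto x (sigma a)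
  - (zeta (1 - a) * x + zeta (1 + a) / (1 + a) * x `^ (1 + a)
     - zeta (- a) / 2).

Definition Lsum x f : R :=
  sum_upto x (fun k =>
    k%:R^-1 * \sum_(1 <= j < k.+1) f (gcdn k j) * ln j%:R).

End ArithmeticalFunctions.

Arguments moebius {R} n.

(* Main.v *)
Require Import Defs.
From mathcomp Require Import zify ring lra.

(* Write [act c F x] for the sum of c(n) F(x/n) over n <= x. Dirichlet convolution of
   weights becomes composition of such operators, so with M = act(mu/id) and
   f(gcd) expanded by Moebius inversion one gets exactly
     L(x; id_(1+a)) = (log x - 1) M(D) - M(T) + M(P),
   where D = sum of sigma_a(n), T = sum of sigma_a(n) log(x/n), and P collects the
   Stirling corrections log(l!)/l - log l + 1; for the Jordan totient M is replaced
   by M o M.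

   No prime number theory is needed for M: applying M to the elementary expansion
   act(1/id)(x^b) = zeta(1+b) x^b - 1/b + O(1/x), whose left side M inverts, gives
   M(x^b) = x^b / zeta(1+b) + O(1), and likewise M(log) = O(log x).  In P, the term
   (log l)/(2l) turns under M into von Mangoldt weights Lambda(n)/n, with total mass
   O(log x); the constant log sqrt(2 pi) is read off from mu/id * 1/id = delta; the
   positive remainder r(l) = O(l^-2) yields Theta = (sum of r(l) l^-(1+a)) / zeta(3+a).

   The one delicate point is T = zeta(1-a) x + zeta(1+a) (1+a)^-2 x^(1+a)
   - zeta(-a)/2 log x + O(1).  Summing first over the divisor weighted by d^a leaves
   an error function E of bounded variation on [1, oo[ (its derivative is O(u^(a-1)))
   such that E(u)/u^2 has an explicit primitive W; so the sum of E(x/m) over m <= x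
   is a Riemann sum equal to x (W(x) - W(1)) up to O(1), and W(x) = zeta(1-a) + O(1/x). *)

Set Implicit Arguments.
Unset Strict Implicit.
Unset Printing Implicit Defensive.

Local Open Scope classical_set_scope.
Local Open Scope ring_scope.

(** * Sums over divisors and the operators [act] *)

Section DivisorSums.
Variable R : realType.
Implicit Types (c d f g : nat -> R) (F G : R -> R) (x y : R) (n k N : nat).

Lemma sum_multiples (k N : nat) (h : nat -> R) : (0 < k)%N ->
  \sum_(1 <= n < N.+1 | (k %| n)%N) h n = \sum_(1 <= l < (N %/ k).+1) h (k * l)%N.
Proof.
move=> k0; elim: N => [|N IH]; first by rewrite div0n !big_geq.
rewrite big_mkcond big_nat_recr //= -big_mkcond IH divnS//.
case: ifPn => [kN|_]; last by rewrite add0n addr0.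
rewrite add1n [in RHS]big_nat_recr //=; congr (_ + h _).
have -> : (N %/ k).+1 = (N.+1 %/ k)%N by rewrite divnS// kN.
by rewrite mulnC divnK.
Qed.

Lemma sum_divisors (n : nat) (N : nat) (h : nat -> R) : (0 < n <= N)%N ->
  \sum_(d <- divisors n) h d = \sum_(1 <= d < N.+1 | (d %| n)%N) h d.
Proof.
case/andP=> n0 nN; rewrite -[in RHS]big_filter; apply: perm_big.
apply: uniq_perm; rewrite ?divisors_uniq ?filter_uniq ?iota_uniq// => d.
rewrite -dvdn_divisors// mem_filter mem_index_iota.
have [dn|//] := boolP (d %| n)%N.
by rewrite /= ltnS (dvdn_gt0 n0 dn) (leq_trans (dvdn_leq n0 dn)).
Qed.

Lemma sum_conv (N : nat) (g : nat -> nat -> R) :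
  \sum_(1 <= n < N.+1) \sum_(d <- divisors n) g d (n %/ d)%N
  = \sum_(1 <= d < N.+1) \sum_(1 <= l < (N %/ d).+1) g d l.
Proof.
rewrite (eq_big_nat _ _
  (F2 := fun n => \sum_(1 <= d < N.+1 | (d %| n)%N) g d (n %/ d)%N)); last first.
  by move=> n /andP[n0 nN]; rewrite (sum_divisors (N := N))// n0.
under eq_bigr do rewrite big_mkcond.
rewrite exchange_big /=; apply: eq_big_nat => d /andP[d0 dN].
rewrite -big_mkcond/= sum_multiples//; apply: eq_bigr => l _.
by rewrite mulKn.
Qed.

Definition act c F x : R := sum_upto x (fun n => c n * F (x / n%:R)).

(** Turns the real cut-off [x / k] of an inner sum into the integer division that [sum_conv]
    produces. *)
Lemma truncn_div x k : 0 <= x -> (0 < k)%N ->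
  Num.truncn (x / k%:R) = (Num.truncn x %/ k)%N.
Proof.
move=> x0 k0; have kR : 0 < k%:R :> R by rewrite ltr0n.
apply/eqP; rewrite eqn_leq -ltnS truncn_lt_nat ?divr_ge0//.
rewrite ltr_pdivrMr// -natrM -truncn_lt_nat//.
rewrite truncn_ge_nat ?divr_ge0// ler_pdivlMr// -natrM -truncn_ge_nat//.
by rewrite leq_trunc_div andbT; rewrite mulnC [(k * _)%N]mulnC ltn_ceil.
Qed.

Lemma sum_uptoE x f : sum_upto x f = \sum_(1 <= n < (Num.truncn x).+1) f n.
Proof. by []. Qed.

Lemma eq_sum_upto x f g : (forall n, (0 < n)%N -> f n = g n) ->
  sum_upto x f = sum_upto x g.
Proof. by move=> fg; apply: eq_big_nat => n /andP[n0 _]; exact: fg. Qed.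

(** [act c F x] samples [F] only at points [x / n] of [1, x], so identities valid for [y >= 1] can
    be substituted under [act]. *)
Lemma act_ext c F G x : 0 <= x -> (forall y, 1 <= y <= x -> F y = G y) ->
  act c F x = act c G x.
Proof.
move=> x0 FG; apply: eq_big_nat => n /andP[n0 nN].
have nR : 0 < n%:R :> R by rewrite ltr0n.
rewrite FG// ler_pdivlMr// mul1r -truncn_ge_nat// -ltnS nN/=.
by rewrite ler_pdivrMr// ler_peMr// ler1n.
Qed.

Lemma act_eqc c d F x : (forall n, (0 < n)%N -> c n = d n) ->
  act c F x = act d F x.
Proof. by move=> cd; apply: eq_sum_upto => n n0; rewrite cd. Qed.

Lemma act2E c d F x : 0 <= x -> act c (act d F) x =
  \sum_(1 <= k < (Num.truncn x).+1) \sum_(1 <= l < (Num.truncn x %/ k).+1)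
     c k * d l * F (x / (k * l)%:R).
Proof.
move=> x0; rewrite /act !sum_uptoE; apply: eq_big_nat => k /andP[k0 _].
rewrite sum_uptoE truncn_div// mulr_sumr; apply: eq_bigr => l _.
by rewrite mulrA natrM invfM [k%:R^-1 * _]mulrC mulrA [X in F X]mulrAC.
Qed.

Lemma act_conv c d F x : 0 <= x ->
  act (dirichlet_conv c d) F x = act c (act d F) x.
Proof.
move=> x0; rewrite act2E// -(sum_conv _ (fun k l => c k * d l * F (x / (k * l)%:R))).
apply: eq_big_nat => n /andP[n0 _]; rewrite /dirichlet_conv mulr_suml.
apply: eq_big_seq => k; rewrite -dvdn_divisors// => kn.
by rewrite [(k * _)%N]mulnC divnK.
Qed.

(** Both sides run over the pairs with k l <= x, a region symmetric in k and l. *)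
Lemma act_comm c d F x : 0 <= x -> act c (act d F) x = act d (act c F) x.
Proof.
move=> x0; rewrite !act2E//; set N := Num.truncn x.
have E (g : nat -> nat -> R) :
    \sum_(1 <= k < N.+1) \sum_(1 <= l < (N %/ k).+1) g k l
    = \sum_(1 <= k < N.+1) \sum_(1 <= l < N.+1 | (k * l <= N)%N) g k l.
  apply: eq_big_nat => k /andP[k0 kN].
  rewrite (big_nat_widen _ _ N.+1) ?ltnS ?leq_div//.
  by apply: eq_bigl => l; rewrite ltnS leq_divRL// mulnC.
rewrite !E; under eq_bigr do rewrite big_mkcond.
rewrite exchange_big/=; apply: eq_bigr => k _.
rewrite -big_mkcond/=; apply: eq_big => l; first by rewrite mulnC.
by move=> _; rewrite mulnC [c l * _]mulrC.
Qed.

Lemma actD c F G x : act c (fun y => F y + G y) x = act c F x + act c G x.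
Proof. by rewrite /act !sum_uptoE -big_split; apply: eq_bigr => n _; rewrite mulrDr. Qed.

Lemma actZ c (k : R) F x : act c (fun y => k * F y) x = k * act c F x.
Proof. by rewrite /act !sum_uptoE mulr_sumr; apply: eq_bigr => n _; rewrite mulrCA. Qed.

Lemma actB c F G x : act c (fun y => F y - G y) x = act c F x - act c G x.
Proof. by rewrite /act !sum_uptoE -sumrB; apply: eq_bigr => n _; rewrite mulrBr. Qed.

Lemma act_addc c d F x : act (fun n => c n + d n) F x = act c F x + act d F x.
Proof. by rewrite /act !sum_uptoE -big_split; apply: eq_bigr => n _; rewrite mulrDl. Qed.

Lemma act_scalec c (k : R) F x : act (fun n => k * c n) F x = k * act c F x.
Proof. by rewrite /act !sum_uptoE mulr_sumr; apply: eq_bigr => n _; rewrite mulrA. Qed.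

Lemma act_delta c F x : 1 <= x -> c 1%N = 1 -> (forall n, (1 < n)%N -> c n = 0) ->
  act c F x = F x.
Proof.
move=> x1 c1 c0; rewrite /act sum_uptoE.
rewrite big_nat_recl ?truncn_gt0//= c1 mul1r divr1 big_nat big1 ?addr0// => n /andP[n0 _].
by rewrite c0// mul0r.
Qed.

End DivisorSums.

(** * The Moebius and von Mangoldt functions *)

Section Moebius.
Variable R : realType.
Implicit Types (f g : nat -> R) (n d p : nat).
Local Notation mu := (@moebius R).

Lemma moebius1 : mu 1 = 1.
Proof. by rewrite /moebius /= expr0. Qed.

Lemma norm_moebius_le1 n : `|mu n| <= 1.
Proof. by rewrite /moebius; case: ifP; rewrite ?normrX ?normrN1 ?expr1n ?normr0. Qed.

Lemma moebius_primeM p d : prime p -> (0 < d)%N -> ~~ (p %| d)%N ->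
  mu (p * d)%N = - mu d.
Proof.
move=> pp d0 pd; have p0 := prime_gt0 pp.
have ppr : perm_eq (primes (p * d)) (p :: primes d).
  apply: uniq_perm; rewrite /= ?primes_uniq ?andbT//.
    by rewrite mem_primes (negbTE pd) !andbF.
  by move=> q; rewrite primesM// primes_prime// inE.
rewrite /moebius muln_gt0 p0 d0 /= (perm_all _ ppr) (perm_size ppr) /=.
rewrite lognM// logn_prime// eqxx (_ : logn p d = 0%N); last first.
  by apply/eqP; rewrite -leqn0 leqNgt logn_gt0 mem_primes (negbTE pd) !andbF.
rewrite addn0 eqxx/=.
have -> : all (fun p0 => logn p0 (p * d) == 1%N) (primes d)
        = all (fun p0 => logn p0 d == 1%N) (primes d).
  apply: eq_in_all => q; rewrite mem_primes => /and3P[pq _ qd].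
  rewrite lognM// logn_prime//; case: (eqVneq q p) => [qp|//].
  by move: qd; rewrite qp (negbTE pd).
by case: ifP => _; rewrite ?oppr0// exprS mulN1r.
Qed.

Lemma moebius_sqr p d : prime p -> (p %| d)%N -> mu (p * d)%N = 0.
Proof.
move=> pp pd; have p0 := prime_gt0 pp.
have [->|d0] := posnP d; first by rewrite muln0.
rewrite /moebius muln_gt0 p0 d0 /=; case: allP => // /(_ p).
rewrite mem_primes pp muln_gt0 p0 d0 dvdn_mulr//= => /(_ isT).
by rewrite lognM// logn_prime// eqxx add1n eqSS -leqn0 leqNgt logn_gt0 mem_primes pp d0 pd.
Qed.

(* The divisors of [n] at which the Moebius function does not vanish pair up as
   [d], [p * d] with opposite signs. *)
Lemma sum_moebius_split n p g : prime p -> (0 < n)%N -> (p %| n)%N ->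
  \sum_(d <- divisors n) mu d * g d
  = \sum_(d <- divisors n | ~~ (p %| d)%N) mu d * (g d - g (p * d)%N).
Proof.
move=> pp n0 pn; have p0 := prime_gt0 pp.
rewrite [RHS]big_mkcond !(sum_divisors (N := n)) ?n0 ?leqnn//=.
rewrite big_mkcond (bigID (fun d => p %| d)%N) /= sum_multiples//.
have -> : \sum_(1 <= l < (n %/ p).+1)
     (if (p * l %| n)%N then mu (p * l)%N * g (p * l)%N else 0)
  = \sum_(1 <= l < n.+1) (if (l %| n)%N && ~~ (p %| l)%N then - mu l * g (p * l)%N else 0).
  rewrite -[RHS]big_mkcond/= [in LHS]big_nat_cond [in RHS]big_nat_cond/=.
  rewrite (eq_bigr (fun l => if ~~ (p %| l)%N && (p * l %| n)%N
                             then - mu l * g (p * l)%N else 0)); last first.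
    move=> l /andP[/andP[l0 _] _]; case: (boolP (p %| l)%N) => pl /=.
      by rewrite moebius_sqr// mul0r if_same.
    by rewrite moebius_primeM.
  rewrite -big_nat_cond -big_mkcond (big_nat_widen _ _ n.+1) ?ltnS ?leq_div//=.
  rewrite [LHS]big_nat_cond; apply: eq_bigl => l.
  case: (boolP (p %| l)%N) => pl /=; first by rewrite ?(andbF, andFb).
  have [->|l0] := posnP l; first by [].
  rewrite andbT !ltnS leq_divRL//.
  have E : (p * l %| n)%N = (l %| n)%N.
    rewrite Gauss_dvd; last by rewrite prime_coprime.
    by rewrite pn.
  rewrite E; case: (boolP (l %| n)%N) => ln //=.
  by have -> : (l * p <= n)%N; rewrite ?andbT// mulnC dvdn_leq// E.
rewrite [X in _ + X]big_mkcond/= -big_split/= [RHS]big_mkcond/=; apply: eq_bigr => l _.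
case: (boolP (p %| l)%N) => pl; case: (boolP (l %| n)%N) => ln//=; rewrite ?addr0//.
by rewrite mulrBr mulNr addrC.
Qed.

Lemma sum_moebius n : (0 < n)%N -> \sum_(d <- divisors n) mu d = (n == 1%N)%:R.
Proof.
move=> n0; case: eqVneq => [->|n1]; first by rewrite (_ : divisors 1 = [:: 1%N])// big_seq1 moebius1.
have n2 : (1 < n)%N by lia.
have := sum_moebius_split (fun=> 1) (pdiv_prime n2) n0 (pdiv_dvd n).
rewrite (eq_bigr mu); last by move=> i _; rewrite mulr1.
by move=> ->; rewrite big1// => i _; rewrite subrr mulr0.
Qed.

(** Encoded as mu * log rather than by its values at prime powers, so that the composition laws of
    [act] apply to it directly. *)
Definition mangoldt n : R := dirichlet_conv mu (fun k => ln k%:R) n.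

(** Pairing d with p d, for a prime p dividing n, each pair contributes [mu d * ln p]. What remains
    is [ln p] times the sum of [mu] over the divisors of the part of n prime to p, which is 0 or
    1. *)
Lemma mangoldt_ge0 n : 0 <= mangoldt n.
Proof.
(* At n = 0 the list of divisors is [[:: 1]], and the logarithm of 0 is 0 by convention. *)
rewrite /mangoldt /dirichlet_conv; have [->|n0] := posnP n; first by
  rewrite (_ : divisors 0 = [:: 1%N])// big_seq1 div0n ln0 ?mulr0.
have [->|n1] := eqVneq n 1%N; first by rewrite (_ : divisors 1 = [:: 1%N])// big_seq1 ln1 mulr0.
have n2 : (1 < n)%N by lia.
have pp := pdiv_prime n2; have pn := pdiv_dvd n.
move: (pdiv n) pp pn => p pp pn.
rewrite (sum_moebius_split (fun d => ln (n %/ d)%:R) pp n0 pn).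
have [m cpm nE] := pfactor_coprime pp n0.
have m0 : (0 < m)%N by case: m cpm nE => // _; rewrite mul0n => nE; rewrite nE in n0.
have -> : \sum_(d <- divisors n | ~~ (p %| d)%N)
      mu d * (ln (n %/ d)%:R - ln (n %/ (p * d))%:R)
    = \sum_(d <- divisors m) ln p%:R * mu d.
  rewrite big_mkcond !(sum_divisors (N := n)) ?n0 ?leqnn//; last first.
    by rewrite m0 [leqRHS]nE leq_pmulr// expn_gt0 prime_gt0.
  rewrite big_mkcond [RHS]big_mkcond/=; apply: eq_bigr => d _.
  have -> : (d %| m)%N = (d %| n)%N && ~~ (p %| d)%N.
    apply/idP/andP => [dm|[dn pd]].
      rewrite nE dvdn_mulr//; split => //; apply/negP => pd.
      by move: cpm; rewrite prime_coprime// (dvdn_trans pd dm).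
    move: dn; rewrite [X in (d %| X)%N]nE Gauss_dvdl//.
    by rewrite coprime_sym coprimeXl// prime_coprime.
  case: (boolP (d %| n)%N) => //= dn; case: (boolP (p %| d)%N) => //= pd.
  have d0 := dvdn_gt0 n0 dn.
  have pdn : (p * d %| n)%N by rewrite Gauss_dvd ?prime_coprime// pn.
  have -> : (n %/ d)%N = (p * (n %/ (p * d)))%N.
    rewrite -{1}(divnK pdn) [(p * d)%N]mulnC [(d * p)%N]mulnC mulnA mulnK//.
    by rewrite mulnC.
  have q0 : (0 < n %/ (p * d))%N by rewrite divn_gt0 ?muln_gt0 ?d0 ?(prime_gt0 pp)// dvdn_leq.
  have lnE : ln (p * (n %/ (p * d)))%:R = ln p%:R + ln (n %/ (p * d))%:R :> R.
    by rewrite natrM lnM// posrE ltr0n ?(prime_gt0 pp).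
  by rewrite lnE addrK mulrC.
rewrite -mulr_sumr sum_moebius//; apply: mulr_ge0 => //.
by apply: ln_ge0; rewrite ler1n (prime_gt0 pp).
Qed.

End Moebius.
Arguments mangoldt {R} n.

(** * Moebius inversion and the exact formula for [Lsum] *)

Section Inversion.
Variable R : realType.
Implicit Types (c d f g : nat -> R) (F G : R -> R) (x y : R) (n k N : nat).
Local Notation mu := (@moebius R).
Local Notation one := (fun=> 1).

Definition over_id c n : R := c n / n%:R.

(** The identity function is completely multiplicative, so dividing by it distributes over
    convolution. *)
Lemma conv_over_id c d n : (0 < n)%N ->
  dirichlet_conv (over_id c) (over_id d) n = over_id (dirichlet_conv c d) n.
Proof.
move=> n0; rewrite /dirichlet_conv /over_id mulr_suml; apply: eq_big_seq => k.
rewrite -dvdn_divisors// => kn; rewrite mulrACA; congr (_ * _).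
by rewrite -invfM -natrM mulnC divnK.
Qed.

Lemma act_conv_over_id c d F x : 0 <= x ->
  act (over_id (dirichlet_conv c d)) F x = act (over_id c) (act (over_id d) F) x.
Proof.
move=> x0; rewrite -act_conv//; apply: act_eqc => n n0.
by rewrite conv_over_id.
Qed.

Lemma conv_moebius_one n : (0 < n)%N -> dirichlet_conv mu one n = (n == 1%N)%:R.
Proof.
move=> n0; rewrite -sum_moebius// /dirichlet_conv.
by apply: eq_bigr => d _; rewrite mulr1.
Qed.

Lemma act_moebiusK F x : 1 <= x -> act mu (act one F) x = F x.
Proof.
move=> x1; rewrite -act_conv ?(le_trans _ x1)//; apply: act_delta => // [|n n1].
  by rewrite conv_moebius_one.
by rewrite conv_moebius_one ?(ltn_trans _ n1)// gtn_eqF.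
Qed.

Lemma act_oneK F x : 1 <= x -> act one (act mu F) x = F x.
Proof. by move=> x1; rewrite act_comm ?(le_trans _ x1)// act_moebiusK. Qed.

Lemma act_moebius_idK F x : 1 <= x ->
  act (over_id mu) (act (over_id one) F) x = F x.
Proof.
move=> x1; rewrite -act_conv_over_id ?(le_trans _ x1)//.
apply: act_delta => // [|n n1].
  by rewrite /over_id conv_moebius_one// divr1.
by rewrite /over_id conv_moebius_one ?(ltn_trans _ n1)// gtn_eqF// mul0r.
Qed.

Lemma sum_act_nat c N : sum_upto N%:R c = act c one (N%:R : R).
Proof. by apply: eq_bigr => n _; rewrite mulr1. Qed.

(** Weights are differences of consecutive partial sums. This brings identities between the
    operators [act] back to pointwise identities. *)
Lemma sum_upto_inj c d : (forall N, sum_upto N%:R c = sum_upto N%:R d) ->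
  forall n, (0 < n)%N -> c n = d n.
Proof.
move=> cd [//|n] _; have := cd n.+1; have := cd n.
rewrite /sum_upto !natrK [in X in _ -> X = _ -> _](big_nat_recr n.+1)//=.
by move=> E; rewrite [in X in _ = X](big_nat_recr n.+1)//= E => /addrI.
Qed.

Lemma moebius_inversion f n : (0 < n)%N ->
  f n = \sum_(d <- divisors n) dirichlet_conv mu f d.
Proof.
move=> n0; have -> : \sum_(d <- divisors n) dirichlet_conv mu f d
    = dirichlet_conv (dirichlet_conv mu f) one n.
  by apply: eq_bigr => d _; rewrite mulr1.
move: n n0; apply: sum_upto_inj => -[|N]; first by rewrite /sum_upto truncn0 !big_geq.
rewrite !sum_act_nat act_conv// act_comm//.
rewrite [RHS](_ : _ = act one (act mu (act f one)) N.+1%:R); last first.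
  by apply: act_ext => // y /andP[y1 _]; rewrite act_conv// (le_trans _ y1).
by rewrite act_oneK// ler1n.
Qed.

Lemma act_mangoldt_one F x : 1 <= x ->
  act one (act mangoldt F) x = act (fun n => ln n%:R) F x.
Proof.
move=> x1; have x0 : 0 <= x by rewrite (le_trans _ x1).
rewrite -(act_oneK (act _ F) x1); apply: act_ext => // y /andP[y1 _].
by rewrite act_conv// (le_trans _ y1).
Qed.

Lemma sum_ln_fact (d l : nat) : (0 < d)%N ->
  \sum_(1 <= j < l.+1) ln (d * j)%:R = l%:R * ln d%:R + ln (l`!)%:R :> R.
Proof.
move=> d0; elim: l => [|l IH]; first by rewrite big_geq// fact0 ln1 mul0r addr0.
rewrite big_nat_recr//= IH natrM lnM ?posrE ?ltr0n// factS natrM lnM ?posrE ?ltr0n ?fact_gt0//.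
rewrite -natr1; ring.
Qed.

Definition stirling_weight (l : nat) : R := ln (l`!)%:R / l%:R - ln l%:R + 1.

(** With k = d l and j = d i, where d divides gcd(k, j), the inner sum is l ln d + ln l!, and
    division by k leaves (g(d) / d) (ln d + ln(l!) / l). The bracket equals (ln x - 1) - ln(x / (d
    l)) + [stirling_weight l], and these are the three terms on the right. *)
Lemma Lsum_act f g x : 0 < x ->
  (forall n, (0 < n)%N -> f n = \sum_(d <- divisors n) g d) ->
  Lsum x f = act (over_id g) (fun y => (ln x - 1) * act one one y
               - act one (@ln R) y + act stirling_weight one y) x.
Proof.
move=> x0 fg; rewrite /Lsum sum_uptoE; set N := Num.truncn x.
transitivity (\sum_(1 <= k < N.+1) \sum_(d <- divisors k)
   (over_id g d * (ln d%:R + ln ((k %/ d)`!)%:R / (k %/ d)%:R))).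
  apply: eq_big_nat => k /andP[k0 kN].
  have -> : \sum_(1 <= j < k.+1) f (gcdn k j) * ln j%:R
    = \sum_(1 <= d < k.+1 | (d %| k)%N) g d * \sum_(1 <= j < k.+1 | (d %| j)%N) ln j%:R.
    transitivity (\sum_(1 <= j < k.+1) \sum_(1 <= d < k.+1)
       (if (d %| k)%N && (d %| j)%N then g d * ln j%:R else 0)).
      apply: eq_big_nat => j /andP[j0 jk].
      have gk : (0 < gcdn k j <= k)%N by rewrite gcdn_gt0 k0 (dvdn_leq k0 (dvdn_gcdl k j)).
      rewrite fg; last by case/andP: gk.
      rewrite (sum_divisors _ gk) mulr_suml [LHS]big_mkcond/=.
      by apply: eq_bigr => d _; rewrite dvdn_gcd.
    rewrite exchange_big/= [RHS]big_mkcond/=; apply: eq_bigr => d _; case: (d %| k)%N => /=.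
      by rewrite mulr_sumr [RHS]big_mkcond.
    by rewrite big1.
  rewrite mulr_sumr (sum_divisors (N := k)) ?k0 ?leqnn//.
  rewrite big_nat_cond [RHS]big_nat_cond.
  apply: eq_bigr => d /andP[/andP[d0 _] dk].
  rewrite sum_multiples// sum_ln_fact// /over_id.
  have q0 : (0 < k %/ d)%N by rewrite divn_gt0// dvdn_leq.
  rewrite (_ : k%:R = (k %/ d)%:R * d%:R :> R); last by rewrite -natrM divnK.
  by field; rewrite !pnatr_eq0 -!lt0n q0 d0.
rewrite (sum_conv _ (fun k l => over_id g k * (ln k%:R + ln (l`!)%:R / l%:R))).
rewrite /act [RHS]sum_uptoE; apply: eq_big_nat => d /andP[d0 _].
rewrite -mulr_sumr; congr (_ * _); rewrite !sum_uptoE truncn_div// ?ltW//.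
rewrite mulr_sumr -sumrB -big_split/=; apply: eq_big_nat => l /andP[l0 _].
rewrite /stirling_weight !mulr1 !ln_div ?posrE ?divr_gt0 ?ltr0n//; ring.
Qed.

End Inversion.

(** * Derivatives, powers, and Euler summation with a majorant *)

Section Calculus.
Variable R : realType.
Implicit Types (f g F M : R -> R) (s t u v x y : R) (n N : nat).

(** The rules of differentiation are restated for functions written as abstractions, so that
    derivatives of explicit formulas are built by nesting proof terms. *)
Lemma is_derive1D f g t df dg : is_derive t 1 f df -> is_derive t 1 g dg ->
  is_derive t 1 (fun z => f z + g z) (df + dg).
Proof. by move=> ? ?; exact: is_deriveD. Qed.

Lemma is_derive1B f g t df dg : is_derive t 1 f df -> is_derive t 1 g dg ->
  is_derive t 1 (fun z => f z - g z) (df - dg).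
Proof. by move=> ? ?; exact: is_deriveB. Qed.

Lemma is_derive1M f g t df dg : is_derive t 1 f df -> is_derive t 1 g dg ->
  is_derive t 1 (fun z => f z * g z) (f t * dg + g t * df).
Proof. by move=> ? ?; exact: is_deriveM. Qed.

Lemma is_derive1Z f t (k df : R) : is_derive t 1 f df ->
  is_derive t 1 (fun z => k * f z) (k * df).
Proof. by move=> ?; exact: is_deriveZ. Qed.

Lemma is_derive1_cst t (k : R) : is_derive t 1 (fun=> k) 0.
Proof. exact: is_derive_cst. Qed.

Lemma is_derive1_inv t : 0 < t -> is_derive t 1 (fun z => z^-1) (- t ^- 2).
Proof.
move=> t0; apply: is_derive_eq; first exact: (is_deriveV (f := id)) (lt0r_neq0 t0) _.
by rewrite scaler1.
Qed.

Lemma mean_value F (dF : R -> R) u v : u <= v ->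
  (forall t, u <= t <= v -> is_derive t 1 F (dF t)) ->
  exists2 t, u <= t <= v & F v - F u = dF t * (v - u).
Proof.
move=> uv dFP; have [||t tuv ->] := @MVT_segment R F dF u v uv.
- by move=> t; rewrite in_itv/= => /andP[ut tv]; apply: dFP; rewrite !ltW.
- apply: derivable_within_continuous => t; rewrite in_itv/= => tuv.
  by have [] := dFP t tuv.
by exists t => //; rewrite in_itv/= in tuv.
Qed.

(** The sign is required only at interior points: in the estimates on unit cells below, the bound on
    the derivative is available only there. *)
Lemma derive_ge0_le F (dF : R -> R) u v : u <= v ->
  (forall t, u <= t <= v -> is_derive t 1 F (dF t)) ->
  (forall t, u < t < v -> 0 <= dF t) -> F u <= F v.
Proof.
rewrite le_eqVlt => /predU1P[->//|uv] dFP dF0.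
have [||t tuv E] := @MVT R F dF u v uv.
- by move=> t; rewrite in_itv/= => /andP[ut tv]; apply: dFP; rewrite !ltW.
- apply: derivable_within_continuous => t; rewrite in_itv/= => tuv.
  by have [] := dFP t tuv.
rewrite -subr_ge0 E mulr_ge0 ?subr_ge0 ?(ltW uv)//.
by apply: dF0; rewrite in_itv/= in tuv.
Qed.

Lemma ler_powRN u v s : 0 < u -> u <= v -> 0 <= s -> v `^ (- s) <= u `^ (- s).
Proof.
move=> u0 uv s0; have v0 := lt_le_trans u0 uv.
by rewrite !powRN lef_pV2 ?posrE ?powR_gt0// ge0_ler_powR// nnegrE ltW.
Qed.

(** From e ln x = ln(x^e) < x^e. *)
Lemma ln_le_powR (e x : R) : 0 < e -> 1 <= x -> ln x <= e^-1 * x `^ e.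
Proof.
move=> e0 x1; have x0 : 0 < x by rewrite (lt_le_trans _ x1).
rewrite mulrC ler_pdivlMr// mulrC -ln_powR ltW// ln_sublinear//.
exact: powR_gt0.
Qed.

Lemma powRD_gt0 x s t : 0 < x -> x `^ (s + t) = x `^ s * x `^ t.
Proof. by move=> x0; rewrite powRD// (gt_eqF x0) implybT. Qed.

Lemma powR_mulB1 x s : 0 < x -> x `^ s = x * x `^ (s - 1).
Proof. by move=> x0; rewrite -{2}(powRr1 (ltW x0)) -powRD_gt0// addrC subrK. Qed.

Lemma cvg_natr_powRN s : 0 < s -> (n%:R : R) `^ (- s) @[n --> \oo] --> (0 : R).
Proof.
move=> s0; apply/cvgrPdist_le => e e0.
near=> n; have n0 : 0 < n%:R :> R by rewrite ltr0n; near: n; exact: nbhs_infty_gt.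
rewrite sub0r normrN ger0_norm ?powR_ge0// powRN invf_ple ?posrE ?powR_gt0//.
have -> : e^-1 = (e^-1 `^ s^-1) `^ s.
  by rewrite -powRrM mulVf ?gt_eqF// powRr1// invr_ge0 ltW.
apply: ge0_ler_powR; rewrite ?nnegrE ?powR_ge0// ?(ltW s0) ?(ltW n0)//.
by near: n; exact: nbhs_infty_ger.
Unshelve. all: by end_near. Qed.

Lemma cvgn_unique (u : nat -> R) (l l' : R) : u @ \oo --> l -> u @ \oo --> l' -> l = l'.
Proof. by move=> cl cl'; rewrite -(cvg_lim (@Rhausdorff R) cl) (cvg_lim _ cl'). Qed.

(** The hypothesis says that u - m increases and u + m decreases. They are adjacent as m tends to 0,
    and their common limit is within m n of u n. *)
Lemma cvg_majorant (u m : nat -> R) :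
  (forall n, (0 < n)%N -> `|u n.+1 - u n| <= m n - m n.+1) ->
  m @ \oo --> 0 ->
  exists l, u @ \oo --> l /\ forall n, (0 < n)%N -> `|u n - l| <= m n.
Proof.
(* The shift avoids the index 0, about which the hypothesis says nothing. *)
move=> um m0; pose a := fun n => u n.+1 - m n.+1; pose b := fun n => u n.+1 + m n.+1.
have na : nondecreasing_seq a.
  apply/nondecreasing_seqP => n; have := um n.+1 isT.
  by rewrite ler_norml /a => /andP[? ?]; lra.
have nb : nonincreasing_seq b.
  apply/nonincreasing_seqP => n; have := um n.+1 isT.
  by rewrite ler_norml /b => /andP[? ?]; lra.
have ms : m n.+1 @[n --> \oo] --> 0 by rewrite (cvg_shiftS m).
have ba : b - a @ \oo --> 0.
  rewrite (_ : b - a = (fun n => 2 * m n.+1)); last first.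
    by apply/funext => n; rewrite /a/b !fctE; ring.
  by rewrite -(mulr0 2); apply: cvgMr.
have [lE ca cb] := adjacent_seq na nb ba.
exists (limn a); split.
  rewrite -(cvg_shiftS u).
  rewrite (_ : (fun n => u n.+1) = a + (fun n => m n.+1)); last first.
    by apply/funext => n; rewrite /a !fctE subrK.
  by rewrite -[limn a]addr0; apply: cvgD.
move=> [//|n] _.
have := nondecreasing_cvgn_le na ca n; have := nonincreasing_cvgn_ge nb cb n.
by rewrite lE /a /b ler_norml => ? ?; lra.
Qed.

(** By the mean value theorem F(n + 1) - F(n) = f(t) with t in [n, n + 1], so passing from n to n +
    1 changes the sum minus F by f(n + 1) - f(t), at most M(n) - M(n + 1). Here [M] bounds the
    variation of [f], which also covers functions that are not monotone. *)
Lemma euler_summation f F M :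
  (forall t, 1 <= t -> is_derive t 1 F (f t)) ->
  (forall t, 1 <= t -> `|f t| <= M t) ->
  (forall u v, 1 <= u -> u <= v -> `|f u - f v| <= M u - M v) ->
  M n%:R @[n --> \oo] --> (0 : R) ->
  exists l, (\sum_(1 <= n < N.+1) f n%:R - F N%:R @[N --> \oo] --> l) /\
    forall x, 1 <= x ->
      `|sum_upto x (fun n => f n%:R) - F x - l| <= 2 * M (Num.truncn x)%:R.
Proof.
move=> dF fM fV M0.
have [n n0|l [ul lP]] := cvg_majorant (u := fun N => \sum_(1 <= n < N.+1) f n%:R - F N%:R) _ M0.
  have n1 : 1 <= n%:R :> R by rewrite ler1n.
  have nn : n%:R <= n.+1%:R :> R by rewrite ler_nat.
  have [|t /andP[nt tn] E] := mean_value nn (F := F) (dF := f).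
    by move=> t /andP[nt _]; apply: dF; rewrite (le_trans n1).
  rewrite big_nat_recr//= (_ : _ - _ = f n.+1%:R - (F n.+1%:R - F n%:R)); last by ring.
  rewrite E -[n.+1%:R - _]addrC -natr1 addKr mulr1 distrC natr1.
  apply: (le_trans (fV _ _ (le_trans n1 nt) tn)).
  by have := fV _ _ n1 nt; have := normr_ge0 (f n%:R - f t); lra.
exists l; split => // x x1; have x0 : 0 <= x by rewrite (le_trans _ x1).
have /andP[Nx xN] := truncn_itv x0; set N := Num.truncn x in Nx xN *.
have N0 : (0 < N)%N by rewrite truncn_gt0.
have N1 : 1 <= N%:R :> R by rewrite ler1n.
have [|t /andP[Nt tx] E] := mean_value Nx (F := F) (dF := f).
  by move=> t /andP[nt _]; apply: dF; rewrite (le_trans N1).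
rewrite sum_uptoE -/N.
rewrite (_ : _ - _ = (\sum_(1 <= n < N.+1) f n%:R - F N%:R - l) - (F x - F N%:R)); last by ring.
(* One copy of [M N] pays for the distance to the limit at N, the other for the increment of F from
   N to x. *)
rewrite mulr_natl mulr2n (le_trans (ler_normB _ _))// lerD ?lP//.
rewrite E normrM (le_trans (ler_piMr _ _))//.
  by rewrite ger0_norm ?subr_ge0//; move: xN; rewrite -natr1; lra.
apply: (le_trans (fM t (le_trans N1 Nt))).
by have := fV _ _ N1 Nt; have := normr_ge0 (f N%:R - f t); lra.
Qed.

Lemma truncn_ge_half x : 1 <= x -> x / 2 <= (Num.truncn x)%:R.
Proof.
move=> x1; have x0 : 0 <= x by rewrite (le_trans _ x1).
have /andP[Nx xN] := truncn_itv x0.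
have : 1 <= (Num.truncn x)%:R :> R by rewrite ler1n truncn_gt0.
by move: xN; rewrite -natr1; lra.
Qed.

Lemma truncn_powRN_le x s : 1 <= x -> 0 <= s ->
  (Num.truncn x)%:R `^ (- s) <= 2 `^ s * x `^ (- s).
Proof.
move=> x1 s0; have x0 : 0 < x by rewrite (lt_le_trans _ x1).
have -> : 2 `^ s * x `^ (- s) = (x / 2) `^ (- s).
  by rewrite powRM ?invr_ge0 ?ltW// mulrC -powR_inv1// -powRrM mulN1r opprK.
by apply: ler_powRN; rewrite ?truncn_ge_half ?divr_gt0.
Qed.

End Calculus.

(** * Partial sums of the zeta series, plain and weighted by a logarithm *)

Section Zeta.
Variable R : realType.
Implicit Types (s t u v x y : R) (n N : nat).

(** Euler summation with [M = f], as t^(-s) decreases. The factor 2^s comes from floor x >= x /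
    2. *)
Lemma sum_powRN_asymp s : 0 < s -> s != 1 ->
  exists l : R,
    (\sum_(1 <= n < N.+1) n%:R `^ (- s) - N%:R `^ (1 - s) / (1 - s) @[N --> \oo] --> l) /\
    forall x, 1 <= x ->
      `|sum_upto x (fun n => n%:R `^ (- s)) - x `^ (1 - s) / (1 - s) - l|
      <= 2 * 2 `^ s * x `^ (- s).
Proof.
move=> s0 s1; have s1' : 1 - s != 0 by rewrite subr_eq0 eq_sym.
have [||||l [cl lP]] := @euler_summation R (fun t => t `^ (- s))
  (fun t => t `^ (1 - s) / (1 - s)) (fun t => t `^ (- s)).
- move=> t t1; have t0 : 0 < t by rewrite (lt_le_trans _ t1).
  apply: is_derive_eq.
    exact: (is_derive1M (is_derive1_powR (1 - s) t0) (is_derive1_cst t (1 - s)^-1)).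
  by rewrite mulr0 add0r mulrA mulVf// mul1r; congr (_ `^ _); ring.
- by move=> t _; rewrite ger0_norm ?powR_ge0.
- move=> u v u1 uv; rewrite ger0_norm// subr_ge0 ler_powRN// ?(ltW s0)//.
  by rewrite (lt_le_trans _ u1).
- exact: cvg_natr_powRN.
exists l; split => // x x1; apply: (le_trans (lP x x1)).
by rewrite -mulrA ler_pM2l// truncn_powRN_le// ltW.
Qed.

Lemma cvg_zeta_series s : 1 < s ->
  \sum_(1 <= n < N.+1) n%:R `^ (- s) @[N --> \oo] --> zeta s.
Proof.
move=> s1; have s0 : 0 < s by rewrite (lt_trans _ s1).
have s1' : s != 1 by rewrite gt_eqF.
have [l [cl _]] := sum_powRN_asymp s0 s1'.
have cP : (N%:R : R) `^ (1 - s) / (1 - s) @[N --> \oo] --> (0 : R).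
  rewrite -[X in _ --> X](mul0r ((1 - s)^-1)).
  apply: cvgMl.
  have -> : 1 - s = - (s - 1) by ring.
  by apply: cvg_natr_powRN; rewrite subr_gt0.
have : \sum_(1 <= n < N.+1) n%:R `^ (- s) @[N --> \oo] --> l.
  rewrite -[l]addr0; apply: cvg_trans (cvgD cl cP).
  by apply: near_eq_cvg; near=> N; rewrite /= fctE subrK.
move=> c; rewrite /zeta s1 (_ : limn _ = l)//.
exact/cvg_lim.
Unshelve. all: by end_near. Qed.

(** The constant is [zeta s] in both ranges: by definition for s < 1, and for s > 1 because N^(1 -
    s) / (1 - s) tends to 0. *)
Lemma sum_powRN_zeta s : 0 < s -> s != 1 ->
  exists C : R, forall x, 1 <= x ->
      `|sum_upto x (fun n => n%:R `^ (- s)) - x `^ (1 - s) / (1 - s) - zeta s|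
      <= C * x `^ (- s).
Proof.
move=> s0 s1; have [l [cl lP]] := sum_powRN_asymp s0 s1.
suff <- : l = zeta s by exists (2 * 2 `^ s).
have [s_gt1|s_le1] := ltP 1 s; last first.
  by apply/esym; rewrite /zeta ltNge s_le1/=; exact/cvg_lim.
have cz := cvg_zeta_series s_gt1.
have cP : (N%:R : R) `^ (1 - s) / (1 - s) @[N --> \oo] --> (0 : R).
  rewrite -[X in _ --> X](mul0r ((1 - s)^-1)); apply: cvgMl.
  have -> : 1 - s = - (s - 1) by ring.
  by apply: cvg_natr_powRN; rewrite subr_gt0.
by apply: (cvgn_unique cl); rewrite -[zeta s]subr0; exact: (cvgB cz cP).
Qed.

Lemma sum_powRN_le_zeta s N : 1 < s -> \sum_(1 <= n < N.+1) n%:R `^ (- s) <= zeta s.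
Proof.
move=> s1; have cz := cvg_zeta_series s1; rewrite -(cvg_lim _ cz)//.
apply: (nondecreasing_cvgn_le (u_ := fun N => \sum_(1 <= n < N.+1) (n%:R : R) `^ (- s))).
  by apply/nondecreasing_seqP => n; rewrite [leRHS]big_nat_recr//= lerDl powR_ge0.
by apply/cvg_ex; exists (zeta s).
Qed.

Lemma zeta_ge1 s : 1 < s -> 1 <= zeta s.
Proof.
move=> s1; apply: le_trans (sum_powRN_le_zeta 1 s1).
by rewrite big_nat1 powR1.
Qed.

Lemma zeta_gt0 s : 1 < s -> 0 < zeta s.
Proof. by move=> s1; rewrite (lt_le_trans _ (zeta_ge1 s1)). Qed.

(** The limit [l] is Euler's constant, but only boundedness is kept. *)
Lemma harmonic_ln : exists C : R, forall x, 1 <= x ->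
  `|sum_upto x (fun n => n%:R^-1) - ln x| <= C.
Proof.
have [||||l [cl lP]] := @euler_summation R (fun t => t^-1) (@ln R) (fun t => t^-1).
- by move=> t t1; apply: is_derive1_ln; rewrite (lt_le_trans _ t1).
- by move=> t t1; rewrite ger0_norm// invr_ge0 (le_trans _ t1).
- move=> u v u1 uv; have u0 : 0 < u by rewrite (lt_le_trans _ u1).
  by rewrite ger0_norm// subr_ge0 lef_pV2// posrE (lt_le_trans u0 uv).
- apply: cvg_trans (cvg_natr_powRN (@ltr01 R)).
  by apply: near_eq_cvg; near=> N; rewrite powR_inv1.
exists (`|l| + 2) => x x1.
rewrite (_ : _ - _ = (sum_upto x (fun n => n%:R^-1) - ln x - l) + l); last by ring.
rewrite (le_trans (ler_normD _ _))// addrC lerD2l (le_trans (lP x x1))//.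
rewrite ler_piMr// invf_le1 ?ltr0n ?truncn_gt0//.
by rewrite ler1n truncn_gt0.
Unshelve. all: by end_near. Qed.

Lemma harmonic_le x : 1 <= x -> sum_upto x (fun n => n%:R^-1) <= 1 + ln x.
Proof.
move=> x1; have x0 : 0 <= x by rewrite (le_trans _ x1).
have /andP[Nx _] := truncn_itv x0.
apply: (@le_trans _ _ (1 + ln (Num.truncn x)%:R)); last first.
  by rewrite lerD2l ler_ln// posrE ?ltr0n ?truncn_gt0// (lt_le_trans _ x1).
rewrite sum_uptoE; have : (0 < Num.truncn x)%N by rewrite truncn_gt0.
elim: (Num.truncn x) => [//|[|N] IH] _; first by rewrite big_nat1 invr1 ln1 addr0.
rewrite big_nat_recr//= (le_trans (lerD (IH isT) (lexx _)))// -addrA lerD2l.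
have n0 : 0 < N.+1%:R :> R by rewrite ltr0n.
have m0 : 0 < N.+2%:R :> R by rewrite ltr0n.
(* [ln (m - 1) - ln m = ln (1 - 1 / m) <= - 1 / m] with [m = N + 2] *)
have : ln (1 + - N.+2%:R^-1) <= - N.+2%:R^-1 :> R.
  by apply: le_ln1Dx; rewrite ltrN2 invf_lt1// ltr1n.
have -> : 1 - N.+2%:R^-1 = N.+1%:R / N.+2%:R :> R.
  have nE : N.+1%:R = N.+2%:R - 1 :> R by rewrite -[in RHS]natr1 addrK.
  by rewrite nE mulrBl divff ?gt_eqF// mul1r.
rewrite ln_div ?posrE//; move: (ln _) (ln _) (_^-1) => p q r; lra.
Qed.

(** Euler summation for ln t t^(-s), with [F] the primitive found by parts. The factor x^(s - 1)
    puts the result in the form met when [act] is applied to y^b with b = s - 1. *)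
Lemma sum_ln_powRN s : 1 < s <= 2 -> exists Z C : R,
  (\sum_(1 <= n < N.+1) ln n%:R * n%:R `^ (- s) @[N --> \oo] --> Z) /\
  forall x, 1 <= x ->
    `|x `^ (s - 1) * sum_upto x (fun n => ln n%:R * n%:R `^ (- s))
      - (Z * x `^ (s - 1) - ln x / (s - 1))| <= C.
Proof.
case/andP=> s1 s2; have s0 : 0 < s by rewrite (lt_trans _ s1).
have b0 : 0 < s - 1 by rewrite subr_gt0.
pose f t : R := ln t * t `^ (- s).
pose F t : R := - (t `^ (1 - s) * ((s - 1)^-1 * ln t + (s - 1) ^- 2)).
(* [f] first increases, then decreases. The constant 2 / s makes both M - f and M + f decreasing:
   the derivative of M + f is - 2 s ln t t^(-s - 1). *)
pose M t : R := f t + 2 / s * t `^ (- s).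
have tp t : 1 <= t -> 0 < t by move=> t1; rewrite (lt_le_trans _ t1).
have df t : 0 < t -> is_derive t 1 f (t `^ (- s - 1) * (1 - s * ln t)).
  move=> t0; apply: is_derive_eq.
    exact: (is_derive1M (is_derive1_ln t0) (is_derive1_powR (- s) t0)).
  by rewrite /= (powR_mulB1 (- s) t0); field; rewrite gt_eqF.
have dF t : 0 < t -> is_derive t 1 F (f t).
  move=> t0; apply: is_derive_eq.
    exact: (is_deriveN (is_derive1M (is_derive1_powR (1 - s) t0)
      (is_derive1D (is_derive1Z (s - 1)^-1 (is_derive1_ln t0))
                   (is_derive1_cst t ((s - 1) ^- 2))))).
  rewrite /f /= (_ : 1 - s - 1 = - s); last by ring.
  rewrite (powR_mulB1 (1 - s) t0) (_ : 1 - s - 1 = - s); last by ring.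
  by field; rewrite !gt_eqF.
have fge0 t : 1 <= t -> 0 <= f t by move=> t1; rewrite mulr_ge0 ?powR_ge0// ln_ge0.
have fM t : 1 <= t -> `|f t| <= M t.
  by move=> t1; rewrite ger0_norm ?fge0// lerDl mulr_ge0 ?powR_ge0// divr_ge0// ltW.
have fV u v : 1 <= u -> u <= v -> `|f u - f v| <= M u - M v.
  move=> u1 uv; have u0 := tp u u1.
  rewrite ler_norml; apply/andP; split; last first.
    rewrite /M; have : v `^ (- s) <= u `^ (- s) by apply: ler_powRN => //; exact: ltW.
    have : 0 <= 2 / s by rewrite divr_ge0// ltW.
    by move=> c0 /(ler_wpM2l c0); lra.
  suff : - (M u + f u) <= - (M v + f v) by lra.
  apply: (derive_ge0_le (F := fun t => - (M t + f t))
    (dF := fun t => - (t `^ (- s - 1) * (1 - s * ln t) + (2 / s * (- s * t `^ (- s - 1)))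
       + t `^ (- s - 1) * (1 - s * ln t))) uv) => t /andP[ut tv].
    have t0 := lt_le_trans u0 ut.
    exact: (is_deriveN (is_derive1D (is_derive1D (df t t0)
      (is_derive1Z (2 / s) (is_derive1_powR (- s) t0))) (df t t0))).
  have t1 : 1 <= t by rewrite (le_trans u1)// ltW.
  rewrite (_ : - _ = 2 * s * ln t * t `^ (- s - 1)); last by field; rewrite gt_eqF.
  by rewrite !mulr_ge0 ?powR_ge0 ?ln_ge0 ?(ltW s0).
have MC t : 1 <= t -> M t <= ((s - 1)^-1 + 2 / s) * t^-1.
  move=> t1; have t0 := tp t t1; rewrite /M /f -mulrDl.
  have -> : t^-1 = t `^ (s - 1) * t `^ (- s).
    by rewrite -powRD_gt0// -powR_inv1 ?(ltW t0)//; congr (_ `^ _); ring.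
  rewrite mulrA ler_wpM2r ?powR_ge0// [leRHS]mulrDl lerD ?ln_le_powR//.
  rewrite ler_peMr ?divr_ge0 ?(ltW s0)//.
  by rewrite -[leLHS](powRr0 t) ler_powR// ltW.
have cM : M n%:R @[n --> \oo] --> (0 : R).
  have h : ((s - 1)^-1 + 2 / s) * (n%:R : R) `^ (-1) @[n --> \oo] --> (0 : R).
    rewrite -[X in _ --> X](mulr0 ((s - 1)^-1 + 2 / s)); apply: cvgMr.
    exact: cvg_natr_powRN.
  apply: (squeeze_cvgr _ (cvg_cst 0) h).
  near=> n; have n1 : 1 <= n%:R :> R by rewrite ler1n; near: n; exact: nbhs_infty_gt.
  rewrite (le_trans _ (fM _ n1))//= powR_inv1 ?ler0n//; exact: MC.
have [t t1|l [cl lP]] := @euler_summation R f F M _ fM fV cM; first exact/dF/tp.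
have FE x : 1 <= x -> x `^ (s - 1) * F x = - (ln x / (s - 1) + (s - 1) ^- 2).
  move=> x1; have x0 := tp x x1.
  rewrite /F mulrN mulrA -powRD_gt0// (_ : s - 1 + (1 - s) = 0); last by ring.
  by rewrite powRr0 mul1r; congr (- (_ + _)); rewrite mulrC.
have cF : F n%:R @[n --> \oo] --> (0 : R).
  (* Half of the decay n^(1 - s) absorbs the logarithm, the other half tends to 0. *)
  pose K := - ((s - 1)^-1 * ((s - 1) / 2)^-1 + (s - 1) ^- 2).
  have h : K * (n%:R : R) `^ (- ((s - 1) / 2)) @[n --> \oo] --> (0 : R).
    rewrite -[X in _ --> X](mulr0 K); apply: cvgMr.
    by apply: cvg_natr_powRN; rewrite divr_gt0.
  apply: (squeeze_cvgr _ h (cvg_cst 0)).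
  near=> n; have n1 : 1 <= n%:R :> R by rewrite ler1n; near: n; exact: nbhs_infty_gt.
  have c0 : 0 <= (s - 1)^-1 by rewrite invr_ge0 ltW.
  have c2 : 0 <= (s - 1) ^- 2 by rewrite invr_ge0 exprn_ge0// ltW.
  rewrite oppr_le0 mulr_ge0 ?powR_ge0 ?addr_ge0 ?mulr_ge0 ?ln_ge0// andbT.
  rewrite /K mulNr lerN2 (_ : 1 - s = - ((s - 1) / 2) + - ((s - 1) / 2)); last by field.
  rewrite powRD_gt0 ?tp// mulrC mulrA ler_wpM2r ?powR_ge0//.
  set w := (n%:R : R) `^ (- _).
  have w1 : w <= 1.
    by rewrite -(powRr0 n%:R) ler_powR// oppr_le0 divr_ge0// ltW.
  have w0 : 0 <= w := powR_ge0 _ _.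
  rewrite mulrDl lerD//; last by rewrite ler_piMr.
  rewrite -mulrA ler_wpM2l// -ler_pdivlMr ?powR_gt0 ?tp//.
  by rewrite /w powRN invrK ln_le_powR// divr_gt0.
exists l, ((s - 1) ^- 2 + 4 * ((s - 1)^-1 + 2 / s)); split.
  rewrite -[l]addr0; apply: cvg_trans (cvgD cl cF).
  by apply: near_eq_cvg; near=> N; rewrite /= fctE subrK.
move=> x x1; have x0 := tp x x1.
rewrite (_ : _ - _ = x `^ (s - 1) * (sum_upto x (fun n => f n%:R) - F x - l)
   - (s - 1) ^- 2); last by rewrite !mulrBr FE//; ring.
rewrite (le_trans (ler_normB _ _))// addrC lerD//.
  by rewrite ger0_norm// invr_ge0 exprn_ge0// ltW.
rewrite normrM ger0_norm ?powR_ge0//.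
have N1 : 1 <= (Num.truncn x)%:R :> R by rewrite ler1n truncn_gt0.
have K0 : 0 <= (s - 1)^-1 + 2 / s by rewrite addr_ge0 ?invr_ge0 ?divr_ge0 ?ltW.
(* As s <= 2, the factor x^(s - 1) is at most x, which the decay 1 / x of [M] compensates. *)
apply: (@le_trans _ _ (x * (2 * (((s - 1)^-1 + 2 / s) * (x / 2)^-1)))); last first.
  by rewrite le_eqVlt; apply/orP; left; apply/eqP; field; rewrite !gt_eqF.
apply: ler_pM; rewrite ?powR_ge0//.
  by rewrite -[leRHS]powRr1 ?(ltW x0)// ler_powR//; lra.
apply: (le_trans (lP x x1)); rewrite ler_pM2l// (le_trans (MC _ N1))//.
rewrite ler_wpM2l// lef_pV2 ?posrE ?divr_gt0 ?(tp _ N1) ?x0 ?ltr0n//.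
exact: truncn_ge_half.
Unshelve. all: by end_near. Qed.

End Zeta.

(** * The derivative of zeta by termwise differentiation *)

Section ZetaDerivative.
Variable R : realType.
Implicit Types (s t u v x y h : R) (n N : nat).

Lemma expR_sub_affine_le t : `|expR t - 1 - t| <= t ^+ 2 * expR `|t|.
Proof.
have g := expR_ge1Dx t; rewrite ger0_norm; last by rewrite -addrA -opprD subr_ge0.
(* e^t - 1 <= t e^t, hence e^t - 1 - t <= t (e^t - 1) *)
have key : expR t - 1 <= t * expR t.
  have := expR_ge1Dx (- t); rewrite -(ler_pM2r (expR_gt0 t)) mulrDl mul1r mulNr.
  by rewrite -expRD addNr expR0; lra.
have [t0|t0] := leP 0 t.
  by rewrite ger0_norm//; nra.
rewrite ltr0_norm//; have : 1 <= expR (- t) by rewrite -expR0 ler_expR; lra.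
by nra.
Qed.

(** With n^(-h) = exp(- h ln n), the second order remainder is at most (h ln n)^2 n^|h|. Each of the
    two logarithms and the factor n^|h| costs n^eta, whence 3 eta. *)
Lemma powRN_sub_affine_le s h n (eta : R) : (0 < n)%N -> 0 < eta -> `|h| <= eta ->
  `|n%:R `^ (- (h + s)) - n%:R `^ (- s) + h * (ln n%:R * n%:R `^ (- s))|
  <= h ^+ 2 * eta ^- 2 * n%:R `^ (- (s - 3 * eta)).
Proof.
move=> n0 e0 he; have nR : 0 < n%:R :> R by rewrite ltr0n.
have n1 : 1 <= n%:R :> R by rewrite ler1n.
have L0 : 0 <= ln n%:R :> R by rewrite ln_ge0.
rewrite (_ : - (h + s) = - h + - s); last by ring.
rewrite powRD_gt0// (_ : - (s - 3 * eta) = eta + (eta + eta + - s)); last by ring.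
rewrite !(powRD_gt0 _ _ nR).
rewrite (_ : _ + _ = (n%:R `^ (- h) - 1 - (- h * ln n%:R)) * n%:R `^ (- s)); last by ring.
rewrite normrM [X in _ * X]ger0_norm ?powR_ge0// !mulrA ler_wpM2r ?powR_ge0//.
have -> : n%:R `^ (- h) = expR (- h * ln n%:R) by rewrite /powR gt_eqF.
apply: (le_trans (expR_sub_affine_le _)).
have E1 : expR `|- h * ln n%:R| <= n%:R `^ eta.
  by rewrite /powR gt_eqF// ler_expR normrM normrN [X in _ * X]ger0_norm// ler_wpM2r.
have E2 : ln n%:R ^+ 2 <= eta ^- 2 * (n%:R `^ eta * n%:R `^ eta).
  rewrite -exprVn -expr2 -exprMn; apply: lerXn2r; rewrite ?nnegrE//.
    by rewrite mulr_ge0 ?powR_ge0// invr_ge0 ltW.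
  exact: ln_le_powR.
rewrite exprMn sqrrN; apply: (@le_trans _ _ (h ^+ 2 * ln n%:R ^+ 2 * n%:R `^ eta)).
  by rewrite ler_wpM2l// mulr_ge0 ?sqr_ge0.
rewrite [leRHS](_ : _ = h ^+ 2 * (eta ^- 2 * (n%:R `^ eta * n%:R `^ eta)) * n%:R `^ eta); last by ring.
by rewrite ler_wpM2r ?powR_ge0// ler_wpM2l ?sqr_ge0.
Qed.

(** Summing the termwise remainders bounds zeta(s + h) - zeta(s) + h Z by K h^2, so the difference
    quotient tends to - Z. *)
Lemma derive1_zeta s (Z : R) : 1 < s ->
  \sum_(1 <= n < N.+1) ln n%:R * n%:R `^ (- s) @[N --> \oo] --> Z ->
  derive1 (@zeta R) s = - Z.
Proof.
(* This choice keeps both s + h and s - 3 eta above 1, where [zeta] is the sum of its series. *)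
move=> s1 cZ; pose eta := (s - 1) / 4.
have e0 : 0 < eta by rewrite divr_gt0// subr_gt0.
have s3 : 1 < s - 3 * eta by rewrite /eta; lra.
pose K := eta ^- 2 * zeta (s - 3 * eta).
have K0 : 0 <= K by rewrite mulr_ge0 ?invr_ge0 ?exprn_ge0 ?ltW// zeta_gt0.
have main h : `|h| <= eta -> `|zeta (h + s) - zeta s + h * Z| <= h ^+ 2 * K.
  move=> he; have hs : 1 < h + s.
    by move: he; rewrite ler_norml /eta => /andP[? ?]; lra.
  have c : `|\sum_(1 <= n < N.+1) n%:R `^ (- (h + s)) - \sum_(1 <= n < N.+1) n%:R `^ (- s)
      + h * \sum_(1 <= n < N.+1) ln n%:R * n%:R `^ (- s)| @[N --> \oo]
     --> `|zeta (h + s) - zeta s + h * Z|.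
    apply: cvg_norm; apply: cvgD; last by apply: cvgMr.
    by apply: cvgB; exact: cvg_zeta_series.
  rewrite -(cvg_lim _ c)//; apply: limr_le; first by apply/cvg_ex; eexists; exact: c.
  near=> N; rewrite mulr_sumr -sumrB -big_split/= (le_trans (ler_norm_sum _ _ _))//.
  apply: (@le_trans _ _ (\sum_(1 <= n < N.+1) h ^+ 2 * eta ^- 2 * n%:R `^ (- (s - 3 * eta)))).
    rewrite big_nat [leRHS]big_nat; apply: ler_sum => n /andP[n0 _].
    exact: powRN_sub_affine_le.
  rewrite -mulr_sumr /K [leRHS]mulrA ler_wpM2l ?sum_powRN_le_zeta//.
  by rewrite mulr_ge0 ?sqr_ge0// invr_ge0 exprn_ge0// ltW.
apply/cvg_lim => //; apply/cvgrPdist_le => e e_gt0.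
near=> h.
have h0 : h != 0 by near: h; exact: nbhs_dnbhs_neq.
have he : `|h| <= eta.
  near: h; apply: dnbhs0_le; exact: e0.
have hk : `|h| <= e / (K + 1).
  by near: h; apply: dnbhs0_le; rewrite divr_gt0// ltr_wpDl.
rewrite (_ : _ - _ = - (h^-1 * (zeta (h + s) - zeta s + h * Z))); last first.
  by rewrite /GRing.scale/=; field.
rewrite normrN normrM normfV ler_pdivrMl ?normr_gt0//.
apply: (le_trans (main h he)).
rewrite -(real_normK (num_real h)) expr2 -mulrA ler_wpM2l//.
move: hk; rewrite ler_pdivlMr ?ltr_wpDl// mulrDr mulr1.
by have := normr_ge0 h; lra.
Unshelve. all: by end_near. Qed.

End ZetaDerivative.

(** * The Wallis integrals *)

Section Wallis.
Variable R : realType.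
Implicit Types (t w x : R) (n : nat).

Lemma is_derive1X (f : R -> R) t (df : R) n : is_derive t 1 f df ->
  is_derive t 1 (fun z => f z ^+ n.+1) (n.+1%:R * f t ^+ n * df).
Proof.
move=> fd; elim: n => [|n IH].
  by rewrite expr0 mulr1 mul1r.
have h := is_derive1M fd IH.
have E : (fun z => f z * f z ^+ n.+1) = (fun z => f z ^+ n.+2).
  by apply/funext => z; rewrite [RHS]exprS.
rewrite E in h; apply: (is_derive_eq h).
by rewrite -[n.+2%:R]natr1 exprS; ring.
Qed.

(* The reduction formula for the integrals of [sin ^+ n], stated for primitives. *)
Fixpoint sin_pow_primitive n : R -> R :=
  match n with
  | 0 => fun t => t
  | 1 => fun t => - cos t
  | (n'.+1 as m).+1 => fun t =>
      n.-1%:R / n%:R * sin_pow_primitive n' t - n%:R^-1 * (cos t * sin t ^+ m)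
  end.

Lemma is_derive_sin_pow n t : is_derive t 1 (sin_pow_primitive n) (sin t ^+ n).
Proof.
(* The recursion goes back two steps, so the induction carries two consecutive cases. *)
suff : is_derive t 1 (sin_pow_primitive n) (sin t ^+ n) /\
       is_derive t 1 (sin_pow_primitive n.+1) (sin t ^+ n.+1) by case.
elim: n => [|n [IH0 IH1]].
  split. rewrite expr0. exact: is_derive_id.
  have h : is_derive t 1 (fun z => - @cos R z) (- - sin t) := is_deriveN (is_derive_cos t).
  rewrite expr1 -[X in is_derive _ _ _ X]opprK. exact: h.
split. exact: IH1.
have h : is_derive t 1 (fun z => n.+1%:R / n.+2%:R * sin_pow_primitive n z
    - n.+2%:R^-1 * (cos z * sin z ^+ n.+1))
  (n.+1%:R / n.+2%:R * sin t ^+ n - n.+2%:R^-1 *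
    (cos t * (n.+1%:R * sin t ^+ n * cos t) + sin t ^+ n.+1 * (- sin t))).
  apply: is_derive1B; apply: is_derive1Z => //.
  apply: is_derive1M. exact: (is_derive1X n (is_derive_sin t)).
have E : (fun z => n.+1%:R / n.+2%:R * sin_pow_primitive n z
    - n.+2%:R^-1 * (cos z * sin z ^+ n.+1)) = sin_pow_primitive n.+2 by [].
rewrite E in h; apply: (is_derive_eq h).
have n2 : (n.+2%:R : R) != 0 by rewrite pnatr_eq0.
rewrite (_ : cos t * _ = n.+1%:R * sin t ^+ n * cos t ^+ 2); last by ring.
rewrite cos2sin2 !exprS expr0.
have -> : n.+1%:R = n.+2%:R - 1 :> R by rewrite -[in RHS]natr1 addrK.
move: n2; move: (n.+2%:R) (sin t ^+ n) => m q m0.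
by field.
Qed.

(* The integral of [sin ^+ n] over [0, pi / 2]. *)
Fixpoint wallis n : R :=
  match n with
  | 0 => pi / 2
  | 1 => 1
  | (n'.+1).+1 => n.-1%:R / n%:R * wallis n'
  end.

Lemma wallisE n : wallis n = sin_pow_primitive n (pi / 2) - sin_pow_primitive n 0.
Proof.
suff : wallis n = sin_pow_primitive n (pi / 2) - sin_pow_primitive n 0 /\
       wallis n.+1 = sin_pow_primitive n.+1 (pi / 2) - sin_pow_primitive n.+1 0 by case.
elim: n => [|n [IH0 IH1]].
  by split=> /=; rewrite ?subr0// cos_pihalf cos0; ring.
split => //=; rewrite IH0 cos_pihalf sin0 expr0n/=; ring.
Qed.

Lemma wallis_decr n : wallis n.+1 <= wallis n.
Proof.
rewrite !wallisE.
suff : sin_pow_primitive n 0 - sin_pow_primitive n.+1 0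
    <= sin_pow_primitive n (pi / 2) - sin_pow_primitive n.+1 (pi / 2) by lra.
apply: (derive_ge0_le (F := fun t => sin_pow_primitive n t - sin_pow_primitive n.+1 t)
   (dF := fun t => sin t ^+ n - sin t ^+ n.+1)).
- by rewrite divr_ge0 ?pi_ge0.
- by move=> t _; apply: is_derive1B; exact: is_derive_sin_pow.
move=> t /andP[t0 tpi]; have s0 : 0 <= sin t.
  apply: sin_ge0_pi; rewrite (ltW t0) (le_trans (ltW tpi))//.
  by have := pi_ge0 R; lra.
by rewrite exprS subr_ge0 ler_piMl ?exprn_ge0// sin_le1.
Qed.

Lemma wallis_gt0 n : 0 < wallis n.
Proof.
suff : 0 < wallis n /\ 0 < wallis n.+1 by case.
elim: n => [|n [h0 h1]]; first by split => //=; rewrite divr_gt0 ?pi_gt0.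
by split => //=; rewrite mulr_gt0// divr_gt0// ltr0n.
Qed.


(** Here and in the odd case the closed form is cleared of denominators, ready for taking
    logarithms. *)
Lemma wallis_even n : wallis n.*2 * (4 ^ n * n`! ^ 2)%:R = pi / 2 * (n.*2)`!%:R.
Proof.
elim: n => [|n IH]; first by rewrite /= fact0 !mulr1.
have n2 : (n.*2.+2%:R : R) != 0 by rewrite pnatr_eq0.
have -> : wallis n.+1.*2 = n.*2.+1%:R / n.*2.+2%:R * wallis n.*2 by [].
have -> : (4 ^ n.+1 * n.+1`! ^ 2 = n.*2.+2 * n.*2.+2 * (4 ^ n * n`! ^ 2))%N.
  by rewrite factS expnS expnMn -doubleS -muln2 !mulnA; lia.
rewrite doubleS !(factS n.*2.+1) (factS n.*2).
move: (4 ^ n * _)%N IH => K IH; rewrite !natrM.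
transitivity (n.*2.+1%:R * n.*2.+2%:R * (wallis n.*2 * K%:R)); last by rewrite IH; ring.
by move: (n.*2.+1%:R) (n.*2.+2%:R) n2 => p q q0; field.
Qed.

Lemma wallis_odd n : wallis n.*2.+1 * (n.*2.+1)`!%:R = (4 ^ n * n`! ^ 2)%:R.
Proof.
elim: n => [|n IH]; first by rewrite /= !mulr1.
have n2 : (n.*2.+3%:R : R) != 0 by rewrite pnatr_eq0.
have -> : wallis n.+1.*2.+1 = n.*2.+2%:R / n.*2.+3%:R * wallis n.*2.+1 by [].
have -> : (4 ^ n.+1 * n.+1`! ^ 2 = n.*2.+2 * n.*2.+2 * (4 ^ n * n`! ^ 2))%N.
  by rewrite factS expnS expnMn -doubleS -muln2 !mulnA; lia.
rewrite [in RHS]natrM -IH doubleS [(n.*2.+3)`!]factS [(n.*2.+2)`!]factS !natrM.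
by move: (n.*2.+2%:R) (n.*2.+3%:R) n2 (_`!%:R) => p q q0 r; field.
Qed.

End Wallis.

(** * Stirling's formula with an explicit nonnegative remainder *)

Section Stirling.
Variable R : realType.
Implicit Types (t w x : R) (n : nat).

(** Compares ln w with its Pade approximant 2 (w - 1) / (w + 1). The middle term vanishes at 1, and
    its derivative ln t + 1 / t - 1 lies between 0 and (t - 1)^2. *)
Lemma ln_pade_bounds w : 1 <= w ->
  0 <= (w + 1) * ln w - 2 * (w - 1) <= (w - 1) ^+ 3.
Proof.
move=> w1.
have lnV_le t : 1 <= t -> 0 <= ln t + t^-1 - 1 <= (t - 1) ^+ 2.
  move=> t1; have t0 : 0 < t by rewrite (lt_le_trans _ t1).
  have h1 : ln t <= t - 1 by have := @le_ln1Dx R (t - 1); rewrite addrCA subrr addr0; apply; lra.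
  have h2 : - ln t <= t^-1 - 1.
    rewrite -lnV ?posrE//; have := @le_ln1Dx R (t^-1 - 1); rewrite addrCA subrr addr0; apply.
    by have : 0 < t^-1 := (ltac:(by rewrite invr_gt0)); lra.
  apply/andP; split; first by lra.
  have : t^-1 - 1 <= (t - 1) ^+ 2 - (t - 1).
    rewrite -subr_ge0 (_ : _ - _ = (t - 1) ^+ 3 / t); last by field; rewrite gt_eqF.
    by rewrite divr_ge0 ?exprn_ge0 ?subr_ge0// ltW.
  by lra.
have dg t : 1 <= t -> is_derive t 1 (fun z => (z + 1) * ln z - 2 * (z - 1)) (ln t + t^-1 - 1).
  move=> t1; have t0 : 0 < t by rewrite (lt_le_trans _ t1).
  apply: is_derive_eq.
    exact: (is_derive1B (is_derive1M (is_derive1D (is_derive_id t 1) (is_derive1_cst t 1)) (is_derive1_ln t0))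
      (is_derive1Z 2 (is_derive1B (is_derive_id t 1) (is_derive1_cst t 1)))).
  by rewrite /=; field; rewrite gt_eqF.
have g1 : (1 + 1) * ln 1 - 2 * (1 - 1) = 0 :> R by rewrite ln1; ring.
apply/andP; split.
  rewrite -[leLHS]g1.
  apply: (derive_ge0_le (F := fun z => (z + 1) * ln z - 2 * (z - 1)) w1).
    by move=> t /andP[t1 _]; exact: dg.
  by move=> t /andP[t1 _]; have /andP[] := lnV_le t (ltW t1).
rewrite -subr_ge0.
have -> : 0 = (1 - 1) ^+ 3 - ((1 + 1) * ln 1 - 2 * (1 - 1)) :> R by rewrite g1; ring.
apply: (derive_ge0_le (F := fun z => (z - 1) ^+ 3 - ((z + 1) * ln z - 2 * (z - 1)))
   (dF := fun t => 3 * (t - 1) ^+ 2 * (1 - 0) - (ln t + t^-1 - 1)) w1).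
  move=> t /andP[t1 _].
  exact: (is_derive1B (is_derive1X 2 (is_derive1B (is_derive_id t 1) (is_derive1_cst t 1))) (dg t t1)).
move=> t /andP[t1 _]; have /andP[_ h] := lnV_le t (ltW t1).
by rewrite subr0 mulr1; have := sqr_ge0 (t - 1); lra.
Qed.

(** The logarithm of n! e^n / n^(n + 1/2). *)
Definition stirling_seq n : R := ln n`!%:R - (n%:R + 2^-1) * ln n%:R + n%:R.

(** The decrement is (n + 1/2) ln w - 1 with w = 1 + 1/n. By [ln_pade_bounds] it is at most 1 / (2
    n^2), hence at most 1/n - 1/(n + 1), a bound that telescopes. *)
Lemma stirling_seq_step n : (0 < n)%N ->
  0 <= stirling_seq n - stirling_seq n.+1 <= n%:R^-1 - n.+1%:R^-1.
Proof.
move=> n0; have nR : 0 < n%:R :> R by rewrite ltr0n.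
have mR : 0 < n.+1%:R :> R by rewrite ltr0n.
pose w : R := n.+1%:R / n%:R.
have wE : w = 1 + n%:R^-1 by rewrite /w -natr1; field; rewrite gt_eqF.
have w1 : 1 <= w by rewrite wE lerDl invr_ge0 ltW.
have -> : stirling_seq n - stirling_seq n.+1
    = n%:R / 2 * ((w + 1) * ln w - 2 * (w - 1)).
  have -> : ln w = ln n.+1%:R - ln n%:R by rewrite ln_div.
  rewrite wE /stirling_seq factS natrM lnM ?posrE ?ltr0n ?fact_gt0// -natr1.
  by field; rewrite gt_eqF.
have /andP[h1 h2] := ln_pade_bounds w1.
have n2 : 0 <= n%:R / 2 :> R by rewrite divr_ge0// ltW.
rewrite mulr_ge0//=; apply: (le_trans (ler_wpM2l n2 h2)).
rewrite wE addrC addKr.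
have n1 : 1 <= n%:R :> R by rewrite ler1n.
rewrite -[n.+1%:R]natr1 -subr_ge0; move: n%:R nR n1 => y y0 y1.
rewrite (_ : _ - _ = (y - 1) / (2 * y ^+ 2 * (y + 1))); last first.
  by field; rewrite !gt_eqF//; lra.
by rewrite divr_ge0 ?subr_ge0// !mulr_ge0 ?exprn_ge0// ?addr_ge0// ltW.
Qed.

Lemma natr_inv_bound_eq0 (c K : R) : (forall n, (0 < n)%N -> `|c| <= K / n%:R) -> c = 0.
Proof.
move=> h; apply/eqP; apply: contraT => c0; have cp : 0 < `|c| by rewrite normr_gt0.
have := h (Num.truncn (K / `|c|)).+1 isT.
rewrite ler_pdivlMr ?ltr0n// mulrC -ler_pdivlMr//.
by rewrite leNgt truncnS_gt.
Qed.

(** [cvg_majorant] gives a limit l. Eliminating (2n)! and n! between the even and odd Wallis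
    formulas gives 2 l = ln(pi / 2) + 2 ln 2. *)
Lemma stirling_seq_asymp n : (0 < n)%N ->
  `|stirling_seq n - ln (Num.sqrt (2 * pi))| <= n%:R^-1.
Proof.
have m0 : (n%:R : R)^-1 @[n --> \oo] --> (0 : R).
  apply: cvg_trans (cvg_natr_powRN (@ltr01 R)).
  by apply: near_eq_cvg; near=> N; rewrite powR_inv1.
have [k k0|l [cl lP]] := cvg_majorant (u := stirling_seq) _ m0.
  by have /andP[? ?] := stirling_seq_step k0; rewrite distrC ger0_norm.
suff <- : l = ln (Num.sqrt (2 * pi)) by exact: lP.
have pi0 : 0 < pi :> R := pi_gt0 R.
rewrite -powR12_sqrt ?mulr_ge0 ?(ltW pi0)// ln_powR lnM ?posrE//.
suff : ln (pi / 2) + 2 * ln 2 - 2 * l = 0.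
  by rewrite ln_div ?posrE//; lra.
(* The 7 adds 4 for the four copies of the sequence at n, 1 for the two copies at 2n, 1 for the
   ratio of consecutive Wallis integrals and 1 for ln(2n + 1) - ln(2n). *)
apply: (@natr_inv_bound_eq0 _ 7) => {}n n0.
have nR : 0 < n%:R :> R by rewrite ltr0n.
have dR : 0 < n.*2%:R :> R by rewrite ltr0n double_gt0.
have oR : 0 < n.*2.+1%:R :> R by rewrite ltr0n.
have fR k : 0 < k`!%:R :> R by rewrite ltr0n fact_gt0.
have We := wallis_gt0 R n.*2; have Wo := wallis_gt0 R n.*2.+1.
have KR : 0 < (4 ^ n * n`! ^ 2)%:R :> R by rewrite ltr0n muln_gt0 !expn_gt0 fact_gt0.
have lnK : ln (4 ^ n * n`! ^ 2)%:R = 2 * n%:R * ln 2 + 2 * ln n`!%:R :> R.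
  rewrite natrM lnM ?posrE ?ltr0n ?expn_gt0 ?fact_gt0// !natrX !lnXn ?fR ?ltr0n//.
  rewrite (_ : 4%:R = 2 ^+ 2 :> R); last by ring.
  by rewrite lnXn//; ring.
have e1 : ln (wallis R n.*2) + (2 * n%:R * ln 2 + 2 * ln n`!%:R) = ln (pi / 2) + ln n.*2`!%:R.
  by rewrite -lnK -!lnM ?posrE ?divr_gt0// wallis_even.
have e2 : ln (wallis R n.*2.+1) + (ln n.*2.+1%:R + ln n.*2`!%:R) = 2 * n%:R * ln 2 + 2 * ln n`!%:R.
  by rewrite -lnK -!lnM ?posrE ?mulr_gt0// -natrM -factS wallis_odd.
have b1 : ln (wallis R n.*2.+1) <= ln (wallis R n.*2).
  by rewrite ler_ln ?posrE// wallis_decr.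
(* Monotonicity one step further: (2n + 1) / (2n + 2) times the integral of index 2n is the one of
   index 2n + 2, at most the one of index 2n + 1. *)
have b2 : ln (wallis R n.*2) <= ln (wallis R n.*2.+1) + n%:R^-1.
  have q0 : 0 < n.*2.+2%:R / n.*2.+1%:R :> R by rewrite divr_gt0 ?ltr0n.
  apply: (@le_trans _ _ (ln (wallis R n.*2.+1 * (n.*2.+2%:R / n.*2.+1%:R)))).
    rewrite ler_ln ?posrE ?mulr_gt0// mulrA ler_pdivlMr// mulrC -ler_pdivrMr ?ltr0n// mulrAC.
    exact: (wallis_decr R n.*2.+1).
  rewrite lnM ?posrE// lerD2l.
  have -> : n.*2.+2%:R / n.*2.+1%:R = 1 + n.*2.+1%:R^-1 :> R.
    by rewrite -[n.*2.+2%:R]natr1 mulrDl divff ?gt_eqF// mul1r.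
  apply: (le_trans (le_ln1Dx _)); first by rewrite (lt_trans (@ltrN10 R))// invr_gt0.
  by rewrite lef_pV2 ?posrE// ler_nat; lia.
have l2n : ln n.*2%:R = ln 2 + ln n%:R :> R.
  by rewrite -muln2 mulnC natrM lnM ?posrE ?ltr0n.
have : (ln 2 + ln n%:R : R) <= ln n.*2.+1%:R <= ln 2 + ln n%:R + (n%:R^-1 : R).
  rewrite -l2n ler_ln ?posrE// ler_nat leqnSn/=.
  have -> : n.*2.+1%:R = n.*2%:R * (1 + n.*2%:R^-1) :> R.
    by rewrite mulrDr mulr1 divff ?gt_eqF// natr1.
  have v0 : 0 < n.*2%:R^-1 :> R by rewrite invr_gt0.
  rewrite lnM ?posrE ?ltr_wpDl// ?addr_gt0// lerD2l.
  apply: (le_trans (le_ln1Dx _)); first by rewrite (lt_trans (@ltrN10 R)).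
  by rewrite lef_pV2 ?posrE// ler_nat; lia.
move=> /andP[p1 p2]; have := lP n n0; have := lP n.*2 (ltac:(by rewrite double_gt0)).
have -> : n.*2%:R^-1 = n%:R^-1 / 2 :> R by rewrite -muln2 natrM invfM.
have d2 : n.*2%:R = 2 * n%:R :> R by rewrite -muln2 natrM mulrC.
rewrite /stirling_seq l2n d2 !ler_norml => /andP[? ?] /andP[? ?].
have v0 : 0 < n%:R^-1 :> R by rewrite invr_gt0.
apply/andP; split; lra.
Unshelve. all: by end_near. Qed.

Lemma stirling_seq_ge n : (0 < n)%N -> ln (Num.sqrt (2 * pi)) <= stirling_seq n.
Proof.
move=> n0; rewrite leNgt; apply/negP => lt_c.
have : ln (Num.sqrt (2 * pi)) - stirling_seq n = 0.
  apply: (@natr_inv_bound_eq0 _ 1) => m m0; rewrite gtr0_norm ?subr_gt0// mul1r.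
  have nm0 : (0 < n + m)%N by rewrite addn_gt0 n0.
  have le_nm : stirling_seq (n + m) <= stirling_seq n.
    elim: m {m0 nm0} => [|m IH]; first by rewrite addn0.
    rewrite addnS (le_trans _ IH)//.
    have /andP[] := @stirling_seq_step (n + m) (ltac:(by rewrite addn_gt0 n0)).
    by rewrite subr_ge0.
  have : (n + m)%:R^-1 <= m%:R^-1 :> R.
    by rewrite lef_pV2 ?posrE ?ltr0n// ler_nat leq_addl.
  move: (stirling_seq_asymp nm0); rewrite ler_norml => /andP[].
  by move: (_^-1) (_^-1) => p q; lra.
by move: lt_c; lra.
Qed.

Definition stirling_rem n : R := (stirling_seq n - ln (Num.sqrt (2 * pi))) / n%:R.

Lemma stirling_rem_ge0 n : 0 <= stirling_rem n.
Proof.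
case: n => [|n]; first by rewrite /stirling_rem invr0 mulr0.
by rewrite divr_ge0// subr_ge0 stirling_seq_ge.
Qed.

Lemma stirling_rem_le n : (0 < n)%N -> stirling_rem n <= n%:R ^- 2.
Proof.
move=> n0; rewrite /stirling_rem -exprVn expr2 ler_wpM2r ?invr_ge0//.
by rewrite (le_trans (ler_norm _))// stirling_seq_asymp.
Qed.

(** The source of Theta > 0: the sequence drops strictly from index 1 to index 2, where it is still
    at least its limit. *)
Lemma stirling_rem1_gt0 : 0 < stirling_rem 1.
Proof.
rewrite /stirling_rem divr1 subr_gt0 (le_lt_trans (@stirling_seq_ge 2 isT))//.
rewrite /stirling_seq !factS fact0 !muln1 ln1 mulr0 subr0 add0r.
(* ln 2 = ln (3/2) + ln (4/3) >= 2/5 + 2/7 > 2/3 *)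
have /andP[h1 _] := @ln_pade_bounds (3 / 2) (ltac:(lra)).
have /andP[h2 _] := @ln_pade_bounds (4 / 3) (ltac:(lra)).
have E : ln 2 = ln (3 / 2) + ln (4 / 3) :> R.
  by rewrite -lnM ?posrE//; congr ln; field.
lra.
Qed.

Lemma stirling_weightE n : (0 < n)%N ->
  stirling_weight R n = 2^-1 * over_id (fun k => ln k%:R) n
    + ln (Num.sqrt (2 * pi)) * over_id (fun=> 1) n + stirling_rem n.
Proof.
move=> n0; have nR : 0 < n%:R :> R by rewrite ltr0n.
rewrite /stirling_weight /over_id /stirling_rem /stirling_seq.
by field; rewrite gt_eqF.
Qed.

End Stirling.

(** * Calculus of errors bounded by powers of the logarithm *)

Section LogBounds.
Variable R : realType.
Implicit Types (F G : R -> R) (c : nat -> R) (x y b : R) (n k : nat).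

(** The bound holds on all of [1, oo[, since [act] evaluates at points down to 1; 1 + ln x replaces
    ln x, which vanishes at 1. *)
Definition log_bounded k F :=
  exists C : R, forall x, 1 <= x -> `|F x| <= C * (1 + ln x) ^+ k.

Lemma ge1_log x : 1 <= x -> 1 <= 1 + ln x.
Proof. by move=> x1; rewrite lerDl ln_ge0. Qed.

Lemma ge0_log x : 1 <= x -> 0 <= 1 + ln x.
Proof. by move=> x1; rewrite (le_trans _ (ge1_log x1)). Qed.

Lemma log_bounded_ge0 k F : log_bounded k F ->
  exists2 C : R, 0 <= C & forall x, 1 <= x -> `|F x| <= C * (1 + ln x) ^+ k.
Proof.
case=> C CP; exists `|C| => // x x1; rewrite (le_trans (CP x x1))// ler_wpM2r//.
  by rewrite exprn_ge0// ge0_log.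
exact: ler_norm.
Qed.

Lemma eq_log_bounded k F G : (forall x, 1 <= x -> F x = G x) ->
  log_bounded k F -> log_bounded k G.
Proof. by move=> FG [C CP]; exists C => x x1; rewrite -FG// CP. Qed.

Lemma log_boundedD k F G : log_bounded k F -> log_bounded k G ->
  log_bounded k (fun x => F x + G x).
Proof.
move=> [C CP] [D DP]; exists (C + D) => x x1.
by rewrite mulrDl (le_trans (ler_normD _ _))// lerD ?CP ?DP.
Qed.

Lemma log_boundedZ k F (a : R) : log_bounded k F -> log_bounded k (fun x => a * F x).
Proof.
move=> [C CP]; exists (`|a| * C) => x x1.
by rewrite normrM -mulrA ler_wpM2l ?CP.
Qed.

Lemma log_boundedB k F G : log_bounded k F -> log_bounded k G ->
  log_bounded k (fun x => F x - G x).
Proof.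
move=> hF /(log_boundedZ (-1)) /(log_boundedD hF); apply: eq_log_bounded => x _.
by rewrite mulN1r.
Qed.

Lemma log_boundedM k l F G : log_bounded k F -> log_bounded l G ->
  log_bounded (k + l) (fun x => F x * G x).
Proof.
move=> [C CP] [D DP]; exists (C * D) => x x1.
by rewrite normrM exprD mulrACA ler_pM ?CP ?DP.
Qed.

Lemma log_boundedW k l F : (k <= l)%N -> log_bounded k F -> log_bounded l F.
Proof.
move=> kl /log_bounded_ge0[C C0 CP]; exists C => x x1.
by rewrite (le_trans (CP x x1))// ler_wpM2l// ler_weXn2l// ge1_log.
Qed.

Lemma log_bounded_cst (a : R) : log_bounded 0 (fun=> a).
Proof. by exists `|a| => x _; rewrite expr0 mulr1. Qed.

Lemma log_bounded_ln : log_bounded 1 (@ln R).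
Proof.
exists 1 => x x1; rewrite mul1r expr1 ger0_norm ?ln_ge0//; lra.
Qed.

Lemma truncn_mem x n : 1 <= x -> (0 < n < (Num.truncn x).+1)%N ->
  1 <= x / n%:R <= x.
Proof.
move=> x1 /andP[n0 nN]; have x0 : 0 <= x by rewrite (le_trans _ x1).
have nR : 0 < n%:R :> R by rewrite ltr0n.
rewrite ler_pdivlMr// mul1r -truncn_ge_nat// -ltnS nN/=.
by rewrite ler_pdivrMr// ler_peMr// ler1n.
Qed.

(** At the points x / n the bound on [F] is at most its value at x, so it factors out of the sum of
    |c(n)|. *)
Lemma log_bounded_act j k c F :
  log_bounded j (fun x => sum_upto x (fun n => `|c n|)) -> log_bounded k F ->
  log_bounded (j + k) (act c F).
Proof.
move=> [K KP] /log_bounded_ge0[C C0 CP]; exists (K * C) => x x1.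
rewrite exprD mulrACA /act sum_uptoE (le_trans (ler_norm_sum _ _ _))//.
have D0 : 0 <= C * (1 + ln x) ^+ k by rewrite mulr_ge0// exprn_ge0// ge0_log.
apply: (@le_trans _ _ (sum_upto x (fun n => `|c n|) * (C * (1 + ln x) ^+ k))).
  rewrite sum_uptoE mulr_suml !big_nat; apply: ler_sum => n nN.
  have /andP[y1 yx] := truncn_mem x1 nN.
  rewrite normrM ler_wpM2l// (le_trans (CP _ y1))// ler_wpM2l//.
  rewrite lerXn2r ?nnegrE ?ge0_log// lerD2l ler_ln ?posrE//.
    exact: lt_le_trans y1.
  by rewrite (lt_le_trans _ x1).
by rewrite ler_wpM2r// (le_trans (ler_norm _))// KP.
Qed.

End LogBounds.

(** * Action of mu/id on powers, logarithms and Stirling corrections *)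

Section MoebiusMeans.
Variable R : realType.
Implicit Types (F G : R -> R) (c : nat -> R) (x y b : R) (n k : nat).
Local Notation one := (fun=> 1).
Local Notation lnn := (fun n => ln n%:R).
Local Notation muid := (over_id (@moebius R)).

Lemma log_bounded_sum_muid : log_bounded 1 (fun x => sum_upto x (fun n => `|muid n|)).
Proof.
exists 1 => x x1; rewrite mul1r expr1 ger0_norm; last by apply: sumr_ge0.
apply: le_trans (harmonic_le x1); rewrite !sum_uptoE; apply: ler_sum => n _.
rewrite /over_id normrM normfV [X in _ / X]ger0_norm//.
by rewrite ler_piMl ?invr_ge0// norm_moebius_le1.
Qed.

Lemma log_bounded_muid k F : log_bounded k F -> log_bounded k.+1 (act muid F).
Proof. exact: log_bounded_act log_bounded_sum_muid. Qed.

(** The bound C n / x at the point x / n cancels the weight 1 / n: each of the floor x terms is at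
    most C / x, and no logarithm is lost. *)
Lemma log_bounded_muid_inv F (C : R) : (forall x, 1 <= x -> `|F x| <= C / x) ->
  log_bounded 0 (act muid F).
Proof.
move=> FC; exists C => x x1; have x0 : 0 < x by rewrite (lt_le_trans _ x1).
have C0 : 0 <= C by have := le_trans (normr_ge0 _) (FC 1 (lexx _)); rewrite divr1.
rewrite expr0 mulr1 /act sum_uptoE (le_trans (ler_norm_sum _ _ _))//.
apply: (@le_trans _ _ (\sum_(1 <= n < (Num.truncn x).+1) C / x)).
  rewrite !big_nat; apply: ler_sum => n nN.
  have /andP[y1 yx] := truncn_mem x1 nN; case/andP: nN => n0 nN.
  have nR : 0 < n%:R :> R by rewrite ltr0n.
  rewrite normrM; apply: (@le_trans _ _ (n%:R^-1 * (C / (x / n%:R)))).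
    rewrite ler_pM ?FC// /over_id normrM normfV [X in _ / X]ger0_norm//.
    by rewrite ler_piMl ?invr_ge0// norm_moebius_le1.
  by rewrite le_eqVlt; apply/orP; left; apply/eqP; field; rewrite !gt_eqF.
rewrite sumr_const_nat subSS subn0 -mulr_natr mulrAC ler_pdivrMr// ler_wpM2l//.
by have /andP[] := truncn_itv (ltW x0).
Qed.

Lemma act_one_oneE y : act (one : nat -> R) one y = (Num.truncn y)%:R.
Proof.
rewrite /act sum_uptoE (eq_bigr (fun=> 1)); last by move=> i _; rewrite mulr1.
by rewrite sumr_const_nat subSS subn0.
Qed.

(* [x] times this sum differs from the sum of [moebius n * floor (x / n)], which is [1],
   by at most [x]. *)
Lemma log_bounded_muid_one : log_bounded 0 (act muid one).
Proof.
exists 2 => x x1; have x0 : 0 < x by rewrite (lt_le_trans _ x1).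
rewrite expr0 mulr1 -(ler_pM2l x0) -[X in X * `|_|](gtr0_norm x0) -normrM.
have E : 1 = \sum_(1 <= n < (Num.truncn x).+1) moebius n * (Num.truncn (x / n%:R))%:R :> R.
  apply: etrans (esym (act_moebiusK one x1)) _; rewrite {1}/act sum_uptoE.
  by apply: eq_bigr => n _; rewrite act_one_oneE.
rewrite (_ : x * _ = 1 + (x * act muid one x - 1)); last by ring.
rewrite mulr_natr mulr2n (le_trans (ler_normD _ _))// normr1 lerD//.
rewrite [X in _ - X]E /act sum_uptoE mulr_sumr -sumrB (le_trans (ler_norm_sum _ _ _))//.
apply: (@le_trans _ _ (\sum_(1 <= n < (Num.truncn x).+1) 1)).
  rewrite !big_nat; apply: ler_sum => n nN.
  have /andP[y1 yx] := truncn_mem x1 nN; case/andP: nN => n0 nN.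
  have nR : 0 < n%:R :> R by rewrite ltr0n.
  rewrite (_ : _ - _ = moebius n * (x / n%:R - (Num.truncn (x / n%:R))%:R)); last first.
    by rewrite /over_id; ring.
  have y0 : 0 <= x / n%:R by rewrite (le_trans _ y1).
  have /andP[t1 t2] := truncn_itv y0.
  rewrite normrM -[leRHS]mulr1 ler_pM ?norm_moebius_le1// ger0_norm ?subr_ge0//.
  by move: t2; rewrite -natr1; move: (_%:R) => p; lra.
rewrite sumr_const_nat subSS subn0.
by have /andP[] := truncn_itv (ltW x0).
Qed.

Lemma act_powR c b x : 0 <= x ->
  act c (fun y => y `^ b) x = x `^ b * sum_upto x (fun n => c n * n%:R `^ (- b)).
Proof.
move=> x0; rewrite /act !sum_uptoE mulr_sumr; apply: eq_big_nat => n /andP[n0 _].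
by rewrite powRM ?invr_ge0// -powR_inv1// -powRrM mulN1r mulrCA.
Qed.

(** The error [e] of the expansion of act(1/id)(y^b) is O(1 / y), so [log_bounded_muid_inv] applies;
    the constant 1 / b is absorbed by [log_bounded_muid_one]. *)
Lemma muid_powR b : 0 < b ->
  log_bounded 0 (fun x => act muid (fun y => y `^ b) x - (zeta (1 + b))^-1 * x `^ b).
Proof.
move=> b0; have s1 : 1 < 1 + b by rewrite ltrDl.
have z0 := zeta_gt0 s1.
have [C CP] := sum_powRN_zeta (lt_trans ltr01 s1) (negbT (gt_eqF s1)).
pose e y := act (over_id one) (fun y => y `^ b) y - (zeta (1 + b) * y `^ b - b^-1).
have eP y : 1 <= y -> `|e y| <= C / y.
  move=> y1; have y0 : 0 < y by rewrite (lt_le_trans _ y1).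
  rewrite /e act_powR ?(ltW y0)//.
  have -> : sum_upto y (fun n => over_id one n * n%:R `^ (- b))
      = sum_upto y (fun n => n%:R `^ (- (1 + b))).
    apply: eq_sum_upto => n n0; have nR : 0 < n%:R :> R by rewrite ltr0n.
    by rewrite /over_id mul1r -powR_inv1 ?ltW// -powRD_gt0// opprD.
  have yb : y `^ b * y `^ (- b) = 1 by rewrite -powRD_gt0// subrr powRr0.
  have -> : C / y = y `^ b * (C * y `^ (- (1 + b))).
    by rewrite mulrCA -powRD_gt0// (_ : b - (1 + b) = -1) ?powR_inv1 ?ltW//; ring.
  rewrite (_ : _ - _ = y `^ b * (sum_upto y (fun n => n%:R `^ (- (1 + b)))
      - y `^ (1 - (1 + b)) / (1 - (1 + b)) - zeta (1 + b))); last first.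
    rewrite (_ : 1 - (1 + b) = - b); last by ring.
    rewrite !mulrBr [y `^ b * (_ / _)]mulrA yb invrN mulrN mul1r opprK; ring.
  by rewrite normrM ger0_norm ?powR_ge0// ler_wpM2l ?powR_ge0// CP.
have := log_boundedZ (zeta (1 + b))^-1 (log_boundedB
   (log_boundedZ b^-1 log_bounded_muid_one) (log_bounded_muid_inv eP)).
apply: eq_log_bounded => x x1; have x0 : 0 <= x by rewrite (le_trans _ x1).
have -> : act muid e x = x `^ b - (zeta (1 + b) * act muid (fun y => y `^ b) x
    - b^-1 * act muid one x).
  rewrite /e actB actB act_moebius_idK// actZ; congr (_ - (_ - _)).
  by rewrite -actZ; apply: act_ext => // y _; rewrite mulr1.
by field; rewrite !gt_eqF.
Qed.

(** The logarithm is act(1/id)(1) up to O(1). Inversion turns the first into 1, and the bounded part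
    costs one logarithm. *)
Lemma muid_ln : log_bounded 1 (act muid (@ln R)).
Proof.
have [C CP] := harmonic_ln R.
have h : log_bounded 0 (fun y => ln y - act (over_id one) one y).
  exists C => x x1; rewrite expr0 mulr1 distrC.
  rewrite (_ : act _ _ _ = sum_upto x (fun n => n%:R^-1)) ?CP//.
  by apply: eq_sum_upto => n _; rewrite /over_id mulr1 mul1r.
have := log_boundedD (log_bounded_muid h) (log_boundedW (leqW (leqnn 0)) (log_bounded_cst 1)).
apply: eq_log_bounded => x x1.
by rewrite actB act_moebius_idK// subrK.
Qed.

(* As [y / 2 <= floor y], the sum is at most [2 / x] times the sum of
   [mangoldt n * floor (x / n)], which is [ln N`!] with [N = floor x]. *)
Lemma log_bounded_sum_mangoldt :
  log_bounded 1 (fun x => sum_upto x (fun n => `|over_id (@mangoldt R) n|)).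
Proof.
exists 2 => x x1; have x0 : 0 < x by rewrite (lt_le_trans _ x1).
rewrite expr1 ger0_norm; last by apply: sumr_ge0.
rewrite -(ler_pM2l x0).
apply: (@le_trans _ _ (2 * act mangoldt (act one one) x)).
  rewrite {1}/act !sum_uptoE !mulr_sumr !big_nat; apply: ler_sum => n nN.
  have /andP[y1 yx] := truncn_mem x1 nN; case/andP: nN => n0 nN.
  rewrite ger0_norm; last by rewrite divr_ge0 ?mangoldt_ge0.
  rewrite act_one_oneE [leLHS](_ : _ = 2 * (mangoldt n * (x / n%:R / 2))); last first.
    by rewrite /over_id; field; rewrite gt_eqF// ltr0n.
  by rewrite ler_wpM2l// ler_wpM2l ?mangoldt_ge0// truncn_ge_half.
rewrite act_comm ?(ltW x0)// act_mangoldt_one// mulrCA ler_wpM2l//.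
rewrite /act sum_uptoE.
apply: (@le_trans _ _ (\sum_(1 <= n < (Num.truncn x).+1) (1 + ln x))).
  rewrite !big_nat; apply: ler_sum => n /andP[n0 nN]; rewrite mulr1.
  have nR : 0 < n%:R :> R by rewrite ltr0n.
  have : ln n%:R <= ln x by rewrite ler_ln ?posrE// -truncn_ge_nat ?(ltW x0).
  by move: (ln n%:R) => p; lra.
rewrite sumr_const_nat subSS subn0 -[leLHS]mulr_natl ler_wpM2r ?ge0_log//.
by have /andP[] := truncn_itv (ltW x0).
Qed.

(** The bounded part of F is treated by the combined weight Lambda(n) / n, of mass O(log x);
    treating mu/id and log/id separately would cost more logarithms. On y^b, act(log/id) is Z y^b -
    ln y / b + O(1), where [muid_powR] and [muid_ln] apply. *)
Lemma muid_lnid b (Z C : R) F (beta : R) : 0 < b ->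
  (forall x, 1 <= x -> `|x `^ b * sum_upto x (fun n => ln n%:R * n%:R `^ (- (1 + b)))
      - (Z * x `^ b - ln x / b)| <= C) ->
  log_bounded 0 (fun x => F x - beta * x `^ b) ->
  log_bounded 1 (fun x => act muid (act (over_id lnn) F) x
                          - beta * Z / zeta (1 + b) * x `^ b).
Proof.
move=> b0 ZP hF.
have hP : log_bounded 0 (fun x => act (over_id lnn) (fun y => y `^ b) x
    - (Z * x `^ b - ln x / b)).
  exists C => x x1; have x0 : 0 <= x by rewrite (le_trans _ x1).
  rewrite expr0 mulr1 act_powR//.
  rewrite (_ : sum_upto x _ = sum_upto x (fun n => ln n%:R * n%:R `^ (- (1 + b)))) ?ZP//.
  apply: eq_sum_upto => n n0; have nR : 0 < n%:R :> R by rewrite ltr0n.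
  by rewrite /over_id -mulrA; congr (_ * _); rewrite -powR_inv1 ?ltW// -powRD_gt0// opprD.
have h1 := log_bounded_muid hP.
have h2 := log_boundedZ Z (log_boundedW (leqW (leqnn 0)) (muid_powR b0)).
have h3 := log_boundedZ b^-1 muid_ln.
have h4 := log_bounded_act log_bounded_sum_mangoldt hF.
have := log_boundedD h4 (log_boundedZ beta (log_boundedB (log_boundedD h1 h2) h3)).
apply: eq_log_bounded => x x1; have x0 : 0 <= x by rewrite (le_trans _ x1).
rewrite !actB !actZ.
have mE G : act (over_id mangoldt) G x = act muid (act (over_id lnn) G) x.
  by rewrite -act_conv_over_id.
rewrite !mE.
have -> : act muid (fun y => ln y / b) x = b^-1 * act muid (@ln R) x.
  by rewrite -actZ; apply: act_ext => // y _; rewrite mulrC.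
ring.
Qed.

(** [Rb] is the sum of r(n) n^(-b), with r the remainder [stirling_rem]. Since r is summable,
    bounded errors stay bounded. *)
Lemma act_stirling_rem b : 0 < b -> exists Rb : R, 0 < Rb /\
  forall F (beta : R), log_bounded 0 (fun x => F x - beta * x `^ b) ->
  log_bounded 0 (fun x => act (@stirling_rem R) F x - beta * Rb * x `^ b).
Proof.
move=> b0.
pose u N : R := \sum_(1 <= n < N.+1) stirling_rem R n * n%:R `^ (- b).
(* The decrement of [m] is t^(-b - 1) for some t in [n, n + 1], which dominates the term of index n
   + 1. *)
pose m n : R := b^-1 * n%:R `^ (- b).
have cm : m @ \oo --> 0.
  rewrite -[X in _ --> X](mulr0 b^-1); apply: cvgMr; exact: cvg_natr_powRN.
have [n n0|Rb [cR RbP]] := cvg_majorant (u := u) _ cm.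
  have nR : 0 < n%:R :> R by rewrite ltr0n.
  have nn : n%:R <= n.+1%:R :> R by rewrite ler_nat.
  have [t /andP[nt _]|t /andP[nt tn] E] := mean_value nn
      (F := fun t => t `^ (- b)) (dF := fun t => - b * t `^ (- b - 1)).
    by apply: is_derive1_powR; rewrite (lt_le_trans nR).
  rewrite /u big_nat_recr//= addrAC subrr add0r ger0_norm; last first.
    by rewrite mulr_ge0 ?powR_ge0 ?stirling_rem_ge0.
  have -> : m n - m n.+1 = t `^ (- b - 1).
    rewrite /m -mulrBr -opprB E -[n.+1%:R]natr1 addrAC subrr add0r mulr1.
    by field; rewrite gt_eqF.
  have t0 : 0 < t by rewrite (lt_le_trans nR).
  apply: (@le_trans _ _ (n.+1%:R `^ (- b - 1))); last first.
    by rewrite -opprD ler_powRN// addr_ge0// ltW.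
  rewrite powRD_gt0 ?ltr0n// mulrC ler_wpM2l ?powR_ge0// (le_trans (stirling_rem_le _ _))//.
  rewrite powR_inv1// lef_pV2 ?posrE ?exprn_gt0 ?ltr0n// expr2 ler_peMr//.
  by rewrite ler1n.
have sum_le N : u N <= Rb.
  rewrite -(cvg_lim _ cR)//.
  apply: (nondecreasing_cvgn_le (u_ := u)); last by apply/cvg_ex; exists Rb.
  apply/nondecreasing_seqP => n; rewrite [leRHS]big_nat_recr//= lerDl.
  by rewrite mulr_ge0 ?powR_ge0 ?stirling_rem_ge0.
exists Rb; split.
  apply: lt_le_trans (sum_le 1%N); rewrite /u big_nat1 powR1 mulr1.
  exact: stirling_rem1_gt0.
move=> F beta hF.
have h1 : log_bounded 0 (fun x => sum_upto x (fun n => `|stirling_rem R n|)).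
  exists (zeta 2) => x x1; rewrite expr0 mulr1 ger0_norm; last by apply: sumr_ge0.
  apply: le_trans (sum_powRN_le_zeta (Num.truncn x) (ltr1n R 2)).
  rewrite sum_uptoE !big_nat; apply: ler_sum => n /andP[n0 _].
  rewrite ger0_norm ?stirling_rem_ge0// (le_trans (stirling_rem_le _ n0))//.
  by rewrite powRN powR_mulrn.
have h2 : log_bounded 0 (fun x => act (stirling_rem R) (fun y => y `^ b) x - Rb * x `^ b).
  exists (b^-1 * 2 `^ b) => x x1; have x0 : 0 < x by rewrite (lt_le_trans _ x1).
  rewrite expr0 mulr1 act_powR ?(ltW x0)// [Rb * _]mulrC -mulrBr normrM ger0_norm ?powR_ge0//.
  have tx : (0 < Num.truncn x)%N by rewrite truncn_gt0.
  apply: (le_trans (ler_wpM2l (powR_ge0 _ _) (RbP _ tx))).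
  rewrite /m mulrCA ler_wpM2l ?invr_ge0 ?(ltW b0)//.
  apply: (le_trans (ler_wpM2l (powR_ge0 _ _) (truncn_powRN_le x1 (ltW b0)))).
  by rewrite mulrCA -powRD_gt0// subrr powRr0 mulr1.
have := log_boundedD (log_bounded_act h1 hF) (log_boundedZ beta h2).
apply: eq_log_bounded => x x1; rewrite actB actZ; ring.
Qed.

End MoebiusMeans.

(** * From unit cells to arbitrary intervals *)

Section UnitCells.
Variable R : realType.
Implicit Types (u v w : R).

(* Propagates an additive estimate from the cells [n, n+1] to all intervals in [1, oo[. *)
Lemma unit_cell_chain (P : R -> R -> Prop) :
  (forall n u v, (0 < n)%N -> n%:R <= u -> u <= v -> v <= n.+1%:R -> P u v) ->
  (forall u w v, 1 <= u -> u <= w -> w <= v -> P u w -> P w v -> P u v) ->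
  forall u v, 1 <= u -> u <= v -> P u v.
Proof.
move=> cell chain u v u1 uv; have u0 : 0 <= u by rewrite (le_trans _ u1).
have /andP[nu un] := truncn_itv u0; set n := Num.truncn u in nu un.
have n0 : (0 < n)%N by rewrite truncn_gt0.
suff H k : forall v, u <= v -> v <= (n + k).+1%:R -> P u v.
  apply: (H (Num.truncn v) v uv); rewrite (le_trans (ltW (truncnS_gt v)))//.
  by rewrite ler_nat ltnS leq_addl.
elim: k => [|k IH] {uv}v uv vk.
  by rewrite addn0 in vk; apply: (cell n) => //; exact: ltW.
have [vk'|vk'] := leP v (n + k).+1%:R; first exact: IH.
have uw : u <= (n + k).+1%:R.
  by rewrite (le_trans (ltW un))// ler_nat ltnS leq_addr.
apply: (chain u (n + k).+1%:R v) => //; first exact: ltW.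
  exact: IH.
apply: (cell (n + k).+1) => //; first exact: ltW.
by rewrite -addnS.
Qed.

End UnitCells.

(** * The sum of sigma_a(n) log(x/n), through a Riemann sum *)

Section WeightedDivisorSum.
Variable R : realType.
Variable a : R.
Implicit Types (u v w x y t : R) (n m k N : nat).
Local Notation b := (1 + a).
Local Notation z0 := (zeta (- a)).
Local Notation one := (fun=> 1).

Let A u := sum_upto u (id_pow a).
Let B u := sum_upto u (fun n => id_pow a n * ln n%:R).
Let S u := sum_upto u (fun n => n%:R `^ (a - 1)).
(* [E] is the error term of [act (id_pow a) ln], and [W] is a primitive of
   [fun u => E u / u ^+ 2]. The jumps of the sums cancel at the integers, so on each
   closed cell [n, n+1] both agree with the smooth functions [Ecell n], [Wcell n]. *)
Let E u := (A u - z0) * ln u - B u - u `^ b / b ^+ 2.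
Let W u := S u - ((A u - z0) * (1 + ln u) - B u) / u - u `^ a / (a * b ^+ 2).

Let Ecell n u := (A n%:R - z0) * ln u - B n%:R - u `^ b / b ^+ 2.
Let Wcell n u := S n%:R - ((A n%:R - z0) * (1 + ln u) - B n%:R) / u
  - u `^ a / (a * b ^+ 2).

Lemma sum_upto_nat (c : nat -> R) n : sum_upto n.+1%:R c = sum_upto n%:R c + c n.+1.
Proof. by rewrite /sum_upto !natrK big_nat_recr. Qed.

Lemma sum_upto_cell (c : nat -> R) n u : n%:R <= u < n.+1%:R ->
  sum_upto u c = sum_upto n%:R c.
Proof. by move=> nu; rewrite /sum_upto (truncn_def nu) natrK. Qed.

Lemma Ecell_eq n u : n%:R <= u <= n.+1%:R -> E u = Ecell n u.
Proof.
case/andP=> nu; rewrite le_eqVlt => /predU1P[->|un].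
  rewrite /E /Ecell /A /B !sum_upto_nat; ring.
by rewrite /E /Ecell /A /B !(@sum_upto_cell _ n u)// nu.
Qed.

Lemma Wcell_eq n u : n%:R <= u <= n.+1%:R -> W u = Wcell n u.
Proof.
case/andP=> nu; rewrite le_eqVlt => /predU1P[->|un].
  rewrite /W /Wcell /A /B /S !sum_upto_nat.
  have n0 : (n.+1%:R : R) != 0 by rewrite pnatr_eq0.
  have -> : n.+1%:R `^ (a - 1) = id_pow a n.+1 / n.+1%:R.
    by rewrite /id_pow powRD_gt0 ?ltr0n// powR_inv1.
  by congr (_ - _); move: (n.+1%:R) n0 (id_pow a n.+1) => q q0 p; field.
by rewrite /W /Wcell /A /B /S !(@sum_upto_cell _ n u)// nu.
Qed.

Hypothesis ha : -1 < a < 0.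

Let a0 : a < 0. Proof. by case/andP: ha. Qed.
Let b0 : 0 < b. Proof. by case/andP: ha; lra. Qed.

Let A_asymp : exists2 K : R, 0 <= K & forall u, 1 <= u ->
  `|A u - u `^ b / b - z0| <= K * u `^ a.
Proof.
have [||K KP] := @sum_powRN_zeta R (- a); first by rewrite oppr_gt0.
  by rewrite lt_eqF//; case/andP: ha; lra.
have KP' u : 1 <= u -> `|A u - u `^ b / b - z0| <= K * u `^ a.
  by move=> u1; have := KP u u1; rewrite !opprK.
exists K => //; have := le_trans (normr_ge0 _) (KP' 1 (lexx _)).
by rewrite powR1 mulr1.
Qed.

Let K := s2val (cid2 A_asymp).
Let K_ge0 : 0 <= K := s2valP (cid2 A_asymp).
Let KP : forall u, 1 <= u -> `|A u - u `^ b / b - z0| <= K * u `^ a :=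
  s2valP' (cid2 A_asymp).
(* [M' u = K * u `^ (a - 1)] dominates [`|E' u|], so [M] majorizes the variation of [E]. *)
Let M u := K / a * u `^ a.

(** On a cell E'(t) = (A(t) - t^b / b - z0) / t, at most K t^(a - 1) in absolute value; hence M - E
    and M + E are nondecreasing. *)
Lemma E_variation_cell n u v : (0 < n)%N -> n%:R <= u -> u <= v -> v <= n.+1%:R ->
  `|E v - E u| <= M v - M u.
Proof.
move=> n0 nu uv vn; have nR : 0 < n%:R :> R by rewrite ltr0n.
rewrite !(@Ecell_eq n) ?nu ?vn ?(le_trans nu uv) ?(le_trans uv vn)//.
pose al : R := A n%:R - z0.
have dE t : 0 < t -> is_derive t 1 (Ecell n) (al * t^-1 - t `^ a / b).
  move=> t0; apply: (is_derive_eq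
    (is_derive1B (is_derive1B (is_derive1Z al (is_derive1_ln t0)) (is_derive1_cst t (B n%:R)))
      (is_derive1M (is_derive1_powR b t0) (is_derive1_cst t (b ^- 2))))).
  by rewrite (_ : b - 1 = a); [field; rewrite gt_eqF//= gt_eqF|ring].
have dM t : 0 < t -> is_derive t 1 M (K * t `^ (a - 1)).
  move=> t0; apply: (is_derive_eq (is_derive1Z (K / a) (is_derive1_powR a t0))).
  by field; rewrite lt_eqF.
have bd t : u < t < v -> `|al * t^-1 - t `^ a / b| <= K * t `^ (a - 1).
  case/andP=> ut tv; have t0 : 0 < t by rewrite (lt_trans (lt_le_trans nR nu)).
  have t1 : 1 <= t by rewrite (le_trans _ (le_trans nu (ltW ut)))// ler1n.
  have := KP t1; rewrite /A (@sum_upto_cell _ n t); last first.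
    by rewrite (le_trans nu (ltW ut)) (lt_le_trans tv vn).
  rewrite -/(A _) (_ : A n%:R - _ - _ = t * (al * t^-1 - t `^ a / b)); last first.
    by rewrite /al powRD_gt0// powRr1 ?ltW//; field; rewrite !gt_eqF.
  rewrite normrM gtr0_norm// -ler_pdivlMl//.
  suff -> : K * t `^ (a - 1) = t^-1 * (K * t `^ a) by [].
  by rewrite powRD_gt0// powR_inv1 ?(ltW t0)//; ring.
have tp t : u <= t -> 0 < t by move=> ut; rewrite (lt_le_trans (lt_le_trans nR nu)).
have h1 : M u - Ecell n u <= M v - Ecell n v.
  apply: (derive_ge0_le (F := fun t => M t - Ecell n t)
    (dF := fun t => K * t `^ (a - 1) - (al * t^-1 - t `^ a / b)) uv).
    by move=> t /andP[ut _]; exact: is_derive1B (dM t (tp t ut)) (dE t (tp t ut)).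
  by move=> t tuv; have := bd t tuv; rewrite ler_norml => /andP[]; lra.
have h2 : M u + Ecell n u <= M v + Ecell n v.
  apply: (derive_ge0_le (F := fun t => M t + Ecell n t)
    (dF := fun t => K * t `^ (a - 1) + (al * t^-1 - t `^ a / b)) uv).
    by move=> t /andP[ut _]; exact: is_derive1D (dM t (tp t ut)) (dE t (tp t ut)).
  by move=> t tuv; have := bd t tuv; rewrite ler_norml => /andP[]; lra.
by rewrite ler_norml; apply/andP; split; lra.
Qed.

(** W' = E / t^2, the integral of 1 / t^2 is 1/u - 1/v, and E stays within M v - M u of E v. *)
Lemma W_increment_cell n u v : (0 < n)%N -> n%:R <= u -> u <= v -> v <= n.+1%:R ->
  `|W v - W u - E v * (u^-1 - v^-1)| <= (M v - M u) * (u^-1 - v^-1).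
Proof.
move=> n0 nu uv vn; have nR : 0 < n%:R :> R by rewrite ltr0n.
have tp t : u <= t -> 0 < t by move=> ut; rewrite (lt_le_trans (lt_le_trans nR nu)).
rewrite (@Wcell_eq n u) ?(@Wcell_eq n v) ?nu ?vn ?(le_trans nu uv) ?(le_trans uv vn)//.
pose al : R := A n%:R - z0.
have dW t : 0 < t -> is_derive t 1 (Wcell n) (Ecell n t * t ^- 2).
  move=> t0; apply: (is_derive_eq
    (is_derive1B (is_derive1B (is_derive1_cst t (S n%:R))
      (is_derive1M (is_derive1B (is_derive1Z al (is_derive1D (is_derive1_cst t 1) (is_derive1_ln t0)))
          (is_derive1_cst t (B n%:R))) (is_derive1_inv t0)))
      (is_derive1M (is_derive1_powR a t0) (is_derive1_cst t ((a * b ^+ 2)^-1))))).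
  rewrite /Ecell -/al /= (_ : t `^ b = t ^+ 2 * t `^ (a - 1)); last first.
    by rewrite -powR_mulrn ?ltW// -powRD_gt0//; congr (_ `^ _); ring.
  by field; rewrite (lt_eqF a0) (gt_eqF b0) (gt_eqF t0).
(* Bounding the integral of E / t^2 amounts to the monotonicity of W + k / t. *)
have half (k : R) : (forall t, u < t < v -> E t <= k) ->
    Wcell n v - Wcell n u <= k * (u^-1 - v^-1).
  move=> Ek.
  suff : - (Wcell n u + k * u^-1) <= - (Wcell n v + k * v^-1) by rewrite mulrBr; lra.
  apply: (derive_ge0_le (F := fun t => - (Wcell n t + k * t^-1))
     (dF := fun t => - (Ecell n t * t ^- 2 + k * - t ^- 2)) uv).
    move=> t /andP[/tp t0 _].
    exact: (is_deriveN (is_derive1D (dW t t0) (is_derive1Z k (is_derive1_inv t0)))).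
  move=> t tuv; have := Ek t tuv; case/andP: tuv => ut tv.
  rewrite (@Ecell_eq n t); last by rewrite (le_trans nu (ltW ut)) (le_trans (ltW tv) vn).
  have t2 : 0 <= t ^- 2 by rewrite invr_ge0 sqr_ge0.
  by move=> /(ler_wpM2r t2); lra.
have half' (k : R) : (forall t, u < t < v -> k <= E t) ->
    k * (u^-1 - v^-1) <= Wcell n v - Wcell n u.
  move=> Ek.
  suff : Wcell n u + k * u^-1 <= Wcell n v + k * v^-1 by rewrite mulrBr; lra.
  apply: (derive_ge0_le (F := fun t => Wcell n t + k * t^-1)
     (dF := fun t => Ecell n t * t ^- 2 + k * - t ^- 2) uv).
    move=> t /andP[/tp t0 _].
    exact: (is_derive1D (dW t t0) (is_derive1Z k (is_derive1_inv t0))).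
  move=> t tuv; have := Ek t tuv; case/andP: tuv => ut tv.
  rewrite (@Ecell_eq n t); last by rewrite (le_trans nu (ltW ut)) (le_trans (ltW tv) vn).
  have t2 : 0 <= t ^- 2 by rewrite invr_ge0 sqr_ge0.
  by move=> /(ler_wpM2r t2); lra.
have Ebd t : u < t < v -> `|E v - E t| <= M v - M u.
  case/andP=> ut tv; have nt := le_trans nu (ltW ut).
  have h1 := E_variation_cell n0 nt (ltW tv) vn.
  have h2 := E_variation_cell n0 nu (ltW ut) (le_trans (ltW tv) vn).
  by move: h1 (le_trans (normr_ge0 _) h2); lra.
rewrite ler_norml; apply/andP; split.
  suff : (E v - (M v - M u)) * (u^-1 - v^-1) <= Wcell n v - Wcell n u by lra.
  by apply: half' => t /Ebd; rewrite ler_norml => /andP[]; lra.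
suff : Wcell n v - Wcell n u <= (E v + (M v - M u)) * (u^-1 - v^-1) by lra.
by apply: half => t /Ebd; rewrite ler_norml => /andP[]; lra.
Qed.

(** The two bounds are chained together: on [u, w] the value E v must replace E w, at a cost
    controlled by the first bound. *)
Lemma EW_increment u v : 1 <= u -> u <= v ->
  `|E v - E u| <= M v - M u /\
  `|W v - W u - E v * (u^-1 - v^-1)| <= (M v - M u) * (u^-1 - v^-1).
Proof.
move: u v; apply: unit_cell_chain => [n u v n0 nu uv vn|u w v u1 uw wv [h1 h2] [h3 h4]].
  by split; [exact: (E_variation_cell n0)|exact: (W_increment_cell n0)].
have u0 : 0 < u by rewrite (lt_le_trans _ u1).
have w0 := lt_le_trans u0 uw; have v0 := lt_le_trans w0 wv.
split.
  rewrite (_ : _ - _ = (E v - E w) + (E w - E u)); last by ring.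
  by rewrite (le_trans (ler_normD _ _))//; lra.
pose i := u^-1 - w^-1; pose j := w^-1 - v^-1.
have i0 : 0 <= i by rewrite subr_ge0 lef_pV2.
have j0 : 0 <= j by rewrite subr_ge0 lef_pV2.
have ijE : u^-1 - v^-1 = i + j by rewrite /i /j; ring.
have m1 : 0 <= M w - M u by rewrite (le_trans _ h1).
have m2 : 0 <= M v - M w by rewrite (le_trans _ h3).
rewrite ijE (_ : _ - _ = (W w - W u - E w * i) + (W v - W w - E v * j)
  - (E v - E w) * i); last by ring.
rewrite (le_trans (ler_normB _ _))//.
have e1 : `|(E v - E w) * i| <= (M v - M w) * i by rewrite normrM [`|i|]ger0_norm// ler_wpM2r.
have := ler_normD (W w - W u - E w * i) (W v - W w - E v * j).
have := mulr_ge0 m1 j0; rewrite -/i in h2; rewrite -/j in h4.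
by move: h2 h4 e1; lra.
Qed.

(** On [1, oo[ the function [M] takes its values between K / a and 0. *)
Let M_range u v : 1 <= u -> u <= v -> M v - M u <= - (K / a).
Proof.
move=> u1 uv; have u0 : 0 < u by rewrite (lt_le_trans _ u1).
have k0 : 0 <= - (K / a) by rewrite -mulrN -invrN divr_ge0// oppr_ge0 ltW.
have : u `^ a <= 1 by rewrite -(powRr0 u) ler_powR// ltW.
by rewrite /M => /(ler_wpM2l k0); have := mulr_ge0 k0 (powR_ge0 v a); lra.
Qed.

Let E_bounded : exists C : R, forall u, 1 <= u -> `|E u| <= C.
Proof.
exists (`|E 1| - K / a) => u u1.
have [h _] := EW_increment (lexx 1) u1; have := M_range (lexx 1) u1.
rewrite -[in `|E u|](subrK (E 1) (E u)) => h2; rewrite (le_trans (ler_normD _ _))//.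
by move: h h2; lra.
Qed.

(** The reciprocals of the points y / m are spaced by 1 / y, so E(y / m) is y times the increment of
    W from y / (m + 1) to y / m, up to the increment of M. Both increments telescope. *)
Lemma sum_E_telescope y k : 1 <= y -> (0 < k <= Num.truncn y)%N ->
  `|\sum_(1 <= m < k) E (y / m%:R) - y * (W y - W (y / k%:R))| <= M y - M (y / k%:R).
Proof.
move=> y1; have y0 : 0 < y by rewrite (lt_le_trans _ y1).
elim: k => [//|[|k] IH] kN.
  by rewrite big_geq// divr1 !subrr mulr0 subrr normr0.
have kR : 0 < k.+1%:R :> R by rewrite ltr0n.
have lR : 0 < k.+2%:R :> R by rewrite ltr0n.
have u1 : 1 <= y / k.+2%:R.
  by rewrite ler_pdivlMr// mul1r -truncn_ge_nat ?(ltW y0)//; lia.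
have uv : y / k.+2%:R <= y / k.+1%:R.
  by rewrite ler_pM2l// lef_pV2 ?posrE// ler_nat.
have [_] := EW_increment u1 uv.
have -> : (y / k.+2%:R)^-1 - (y / k.+1%:R)^-1 = y^-1.
  by rewrite !invfM !invrK -mulrBr -[k.+2%:R]natr1 addrAC subrr add0r mulr1.
set u := y / k.+2%:R; set v := y / k.+1%:R => h.
have {}h : `|E v - y * (W v - W u)| <= M v - M u.
  rewrite (_ : _ - _ = - (y * (W v - W u - E v * y^-1))); last by field; rewrite gt_eqF.
  by rewrite normrN normrM gtr0_norm// -ler_pdivlMl// [leRHS]mulrC.
have := IH (ltac:(lia)); rewrite -/v => {}IH.
rewrite big_nat_recr//= -/v.
rewrite (_ : _ - _ = (\sum_(1 <= m < k.+1) E (y / m%:R) - y * (W y - W v))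
   + (E v - y * (W v - W u))); last by ring.
by rewrite (le_trans (ler_normD _ _))//; move: IH h; lra.
Qed.

(** The quantity splits exactly into y times the error of S, minus the error of A, minus E; all
    three are bounded. *)
Lemma W_asymp : exists C : R, forall y, 1 <= y -> `|y * (W y - zeta (1 - a))| <= C.
Proof.
have [C CP] := E_bounded.
have [||D DP] := @sum_powRN_zeta R (1 - a); first by move: a0; lra.
  by rewrite gt_eqF//; move: a0; lra.
have D0 : 0 <= D by have := le_trans (normr_ge0 _) (DP 1 (lexx _)); rewrite powR1 mulr1.
exists (D + K + C) => y y1; have y0 : 0 < y by rewrite (lt_le_trans _ y1).
have ya : y `^ a <= 1 by rewrite -(powRr0 y) ler_powR// ltW.
have h1 : `|y * (S y - y `^ a / a - zeta (1 - a))| <= D.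
  rewrite normrM gtr0_norm//.
  have := DP y y1; rewrite (_ : 1 - (1 - a) = a); last by ring.
  have -> : sum_upto y (fun n => n%:R `^ (- (1 - a))) = S y.
    by apply: eq_sum_upto => n _; rewrite opprB.
  rewrite opprB powRD_gt0// powR_inv1 ?(ltW y0)// => /(ler_wpM2l (ltW y0)) h.
  rewrite (le_trans h)// (_ : y * _ = D * y `^ a); last by field; rewrite gt_eqF.
  by rewrite ler_piMr.
have h2 : `|A y - y `^ b / b - z0| <= K.
  by rewrite (le_trans (KP y1))// ler_piMr.
have h3 := CP y y1.
rewrite (_ : y * _ = y * (S y - y `^ a / a - zeta (1 - a)) - (A y - y `^ b / b - z0) - E y).
  have := ler_normB (y * (S y - y `^ a / a - zeta (1 - a)) - (A y - y `^ b / b - z0)) (E y).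
  have := ler_normB (y * (S y - y `^ a / a - zeta (1 - a))) (A y - y `^ b / b - z0).
  by move: h1 h2 h3; lra.
rewrite /W /E (_ : y `^ b = y * y `^ a); last by rewrite powRD_gt0// powRr1// ltW.
by field; rewrite (lt_eqF a0) (gt_eqF b0) (gt_eqF y0).
Qed.

(** The coefficient is zeta(1 - a) - W(1). The telescoping stops at v = y / N with N = floor y; from
    1 to v, y (1 - 1/v) = y - N is at most 1, so this gap costs O(1). *)
Lemma act_one_E :
  log_bounded 0 (fun y => act one E y - (zeta (1 - a) - z0 + (a * b ^+ 2)^-1) * y).
Proof.
have [C CP] := E_bounded; have [D DP] := W_asymp.
exists (D + - (K / a) + (C - K / a) + C) => y y1; rewrite expr0 mulr1.
have y0 : 0 < y by rewrite (lt_le_trans _ y1).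
have N0 : (0 < Num.truncn y)%N by rewrite truncn_gt0.
have NR : 0 < (Num.truncn y)%:R :> R by rewrite ltr0n.
have /andP[Ny yN] := truncn_itv (ltW y0).
set N := Num.truncn y in N0 NR Ny yN *.
have v1 : 1 <= y / N%:R by rewrite ler_pdivlMr// mul1r.
have vy : y / N%:R <= y by rewrite ler_pdivrMr// ler_peMr ?(ltW y0)// ler1n.
have h1 := sum_E_telescope y1 (ltac:(by rewrite N0 leqnn) : (0 < N <= Num.truncn y)%N).
have h2 := M_range v1 vy.
have [h3 h4] := EW_increment (lexx 1) v1.
have h5 := M_range (lexx 1) v1.
have h6 : `|y * (W (y / N%:R) - W 1)| <= C - K / a.
  have q : y * (1^-1 - (y / N%:R)^-1) = y - N%:R.
    by rewrite invr1 invfM invrK mulrBr mulr1 mulVKf ?gt_eqF.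
  have q1 : y - N%:R <= 1 by move: yN; rewrite -natr1; lra.
  have q0 : 0 <= y - N%:R by rewrite subr_ge0.
  have i0 : 0 <= 1^-1 - (y / N%:R)^-1 by rewrite -(pmulr_rge0 _ y0) q.
  rewrite (_ : _ * _ = y * (W (y / N%:R) - W 1 - E (y / N%:R) * (1^-1 - (y / N%:R)^-1))
    + E (y / N%:R) * (y * (1^-1 - (y / N%:R)^-1))); last by ring.
  rewrite q (le_trans (ler_normD _ _))// addrC lerD//.
    by rewrite normrM (ger0_norm q0) (le_trans (ler_piMr _ q1))// CP.
  rewrite normrM gtr0_norm// (le_trans (ler_wpM2l (ltW y0) h4))// mulrCA q.
  have M0 : 0 <= M (y / N%:R) - M 1 by rewrite (le_trans _ h3).
  by rewrite (le_trans (ler_piMr _ q1)).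
have W1 : W 1 = z0 - (a * b ^+ 2)^-1.
  rewrite /W /S /A /B /sum_upto truncn1 !big_nat1 /id_pow !powR1 ln1 invr1.
  by field; rewrite (lt_eqF a0) (gt_eqF b0).
have aE : act one E y = \sum_(1 <= m < N) E (y / m%:R) + E (y / N%:R).
  rewrite /act sum_uptoE -/N -[N in LHS]prednK// big_nat_recr//= prednK// mul1r.
  by congr (_ + _); apply: eq_bigr => i _; rewrite mul1r.
have h7 := CP _ v1; have h8 := DP y y1.
rewrite aE (_ : _ - _ = (\sum_(1 <= m < N) E (y / m%:R) - y * (W y - W (y / N%:R)))
   + (y * (W y - zeta (1 - a)) - y * (W (y / N%:R) - W 1)) + E (y / N%:R)); last first.
  by rewrite W1; ring.
have := ler_normD (\sum_(1 <= m < N) E (y / m%:R) - y * (W y - W (y / N%:R))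
   + (y * (W y - zeta (1 - a)) - y * (W (y / N%:R) - W 1))) (E (y / N%:R)).
have := ler_normD (\sum_(1 <= m < N) E (y / m%:R) - y * (W y - W (y / N%:R)))
   (y * (W y - zeta (1 - a)) - y * (W (y / N%:R) - W 1)).
have := ler_normB (y * (W y - zeta (1 - a))) (y * (W (y / N%:R) - W 1)).
by move: h1 h2 h6 h7 h8; lra.
Qed.

(** The sum is N ln y - ln N! with N = floor y, and Stirling's formula applies. *)
Lemma act_one_ln : log_bounded 0 (fun y => act one (@ln R) y - (y - ln y / 2)).
Proof.
exists (4 + `|ln (Num.sqrt (2 * pi))|) => y y1; rewrite expr0 mulr1.
have y0 : 0 < y by rewrite (lt_le_trans _ y1).
have N0 : (0 < Num.truncn y)%N by rewrite truncn_gt0.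
have NR : 0 < (Num.truncn y)%:R :> R by rewrite ltr0n.
have N1 : 1 <= (Num.truncn y)%:R :> R by rewrite ler1n.
have /andP[Ny yN] := truncn_itv (ltW y0).
have aE : act one (@ln R) y = (Num.truncn y)%:R * ln y - ln (Num.truncn y)`!%:R.
  have := sum_ln_fact R (Num.truncn y) (ltn0Sn 0); rewrite ln1 mulr0 add0r => <-.
  rewrite /act sum_uptoE.
  rewrite (eq_big_nat _ _ (F2 := fun n => ln y - ln (1 * n)%:R)); last first.
    by move=> n /andP[n0 _]; rewrite mul1n mul1r ln_div ?posrE ?ltr0n.
  by rewrite sumrB sumr_const_nat subSS subn0 mulr_natl.
have yN1 : y - (Num.truncn y)%:R <= 1 by move: yN; rewrite -natr1; lra.
have d0 : ln (Num.truncn y)%:R <= ln y by rewrite ler_ln.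
have d1 : (Num.truncn y)%:R * (ln y - ln (Num.truncn y)%:R) <= 1.
  rewrite -ln_div// mulrC -ler_pdivlMr//.
  have q0 : 0 < y / (Num.truncn y)%:R by rewrite divr_gt0.
  have q1 : -1 < y / (Num.truncn y)%:R - 1 by lra.
  have := le_ln1Dx q1; rewrite addrCA subrr addr0 => /le_trans; apply.
  by rewrite -[X in _ - X](divff (lt0r_neq0 NR)) -mulrBl ler_wpM2r// invr_ge0 ltW.
have d2 : ln y - ln (Num.truncn y)%:R <= 1.
  by rewrite (le_trans _ d1)// ler_peMl// subr_ge0.
have d3 : 0 <= (Num.truncn y)%:R * (ln y - ln (Num.truncn y)%:R).
  by rewrite mulr_ge0 ?subr_ge0// ltW.
have := stirling_seq_asymp R N0; rewrite aE /stirling_seq.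
have : (Num.truncn y)%:R^-1 <= 1 :> R by rewrite invf_le1.
move: (Num.truncn y)%:R (_^-1) (ln _`!%:R) Ny yN1 d0 d1 d2 d3 => N i f Ny yN1 d0 d1 d2 d3 i1.
have := ler_norm (ln (Num.sqrt (2 * pi)) : R); have := ler_norm (- ln (Num.sqrt (2 * pi)) : R).
rewrite normrN; move: (ln (Num.sqrt _)) => c c1 c2; rewrite !ler_norml => /andP[h1 h2].
by apply/andP; split; lra.
Qed.

Lemma act_one_powR :
  log_bounded 0 (fun y => act one (fun u => u `^ b) y - (zeta b * y `^ b - y / a)).
Proof.
have b1 : b != 1 by rewrite lt_eqF//; move: a0; lra.
have [C CP] := sum_powRN_zeta b0 b1; exists C => y y1; rewrite expr0 mulr1.
have y0 : 0 < y by rewrite (lt_le_trans _ y1).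
have yb : y `^ b * y `^ (- b) = 1 by rewrite -powRD_gt0// subrr powRr0.
have := CP y y1 => /(ler_wpM2l (powR_ge0 y b)).
rewrite mulrCA yb mulr1 -{1}(ger0_norm (powR_ge0 y b)) -normrM; apply: le_trans.
rewrite act_powR ?(ltW y0)// le_eqVlt; apply/orP; left; apply/eqP; congr (`|_|).
rewrite (_ : sum_upto y (fun n => 1 * _) = sum_upto y (fun n => n%:R `^ (- b))); last first.
  by apply: eq_sum_upto => n _; rewrite mul1r.
have yE : y = y `^ b * y `^ (1 - b) by rewrite -powRD_gt0// addrC subrK powRr1// ltW.
rewrite [y in y / a]yE (_ : 1 - b = - a); last by ring.
by field; rewrite lt_eqF.
Qed.

(** By the definition of [E], act(id^a)(ln) is E + u^b / b^2 + z0 ln u. Summing the three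
    contributions, the extra terms in y cancel and leave zeta(1 - a) y. *)
Lemma sigma_log_sum : log_bounded 0 (fun y => act (id_pow a) (act one (@ln R)) y
  - (zeta (1 - a) * y + zeta b / b ^+ 2 * y `^ b - z0 / 2 * ln y)).
Proof.
have := log_boundedD act_one_E (log_boundedD (log_boundedZ (b ^- 2) act_one_powR)
  (log_boundedZ z0 act_one_ln)).
apply: eq_log_bounded => y y1; have y0 : 0 < y by rewrite (lt_le_trans _ y1).
have -> : act (id_pow a) (act one (@ln R)) y
    = act one E y + (b ^- 2 * act one (fun u => u `^ b) y + z0 * act one (@ln R) y).
  rewrite act_comm ?(ltW y0)// -!actZ -!actD; apply: act_ext; first exact: ltW.
  move=> u /andP[u1 _]; have u0 : 0 < u by rewrite (lt_le_trans _ u1).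
  rewrite /E /A /B /act !sum_uptoE.
  rewrite (eq_big_nat _ _ (F2 := fun n => id_pow a n * ln u - id_pow a n * ln n%:R)); last first.
    by move=> n /andP[n0 _]; rewrite ln_div ?posrE ?ltr0n// mulrBr.
  by rewrite sumrB -mulr_suml; field; rewrite gt_eqF.
by field; rewrite (lt_eqF a0) (gt_eqF b0).
Qed.

End WeightedDivisorSum.

(** * The three means, and [Lsum] in terms of them *)

Section Assembly.
Variable R : realType.
Variable a : R.
Hypothesis ha : -1 < a < 0.
Implicit Types (F G : R -> R) (x y : R) (n k : nat).
Local Notation b := (1 + a).
Local Notation one := (fun=> 1).
Local Notation lnn := (fun n => ln n%:R).
Local Notation muid := (over_id (@moebius R)).
Local Notation pa := (@id_pow R a).

Let a0 : a < 0. Proof. by case/andP: ha. Qed.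
Let b0 : 0 < b. Proof. by case/andP: ha; lra. Qed.

Lemma muid_id : log_bounded 0 (fun x => act muid id x - x / zeta 2).
Proof.
have := muid_powR (@ltr01 R); apply: eq_log_bounded => x x1.
have x0 : 0 <= x by rewrite (le_trans _ x1).
rewrite powRr1// [x / _]mulrC (_ : 1 + 1 = 2 :> R)//; congr (_ - _).
by apply: act_ext => // y /andP[y1 _]; rewrite powRr1// (le_trans _ y1).
Qed.

Lemma muid_powRb :
  log_bounded 0 (fun x => act muid (fun y => y `^ b) x - x `^ b / zeta (2 + a)).
Proof.
have := muid_powR b0; apply: eq_log_bounded => x _.
by rewrite mulrC (_ : 1 + b = 2 + a)//; ring.
Qed.

(** One application of mu/id in a form that can be iterated, at the price of one logarithm in the
    error. *)
Lemma muid_step k F G (al be : R) :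
  log_bounded k (fun x => F x - (al * x + be * x `^ b + G x)) ->
  log_bounded k.+1 (fun x => act muid F x
    - (al / zeta 2 * x + be / zeta (2 + a) * x `^ b + act muid G x)).
Proof.
move=> /log_bounded_muid hF.
have := log_boundedD hF (log_boundedD
  (log_boundedZ al (log_boundedW (leq0n k.+1) muid_id))
  (log_boundedZ be (log_boundedW (leq0n k.+1) muid_powRb))).
apply: eq_log_bounded => x x1; have x0 : 0 <= x by rewrite (le_trans _ x1).
by rewrite actB !actD !actZ; ring.
Qed.

Lemma sum_sigmaE x : 0 <= x -> sum_upto x (sigma a) = act pa (act one one) x.
Proof.
move=> x0; rewrite -act_conv// /act; apply: eq_sum_upto => n _; rewrite mulr1.
by apply: eq_bigr => d _; rewrite mulr1.
Qed.

(** [Delta] is carried along exactly. The error stays O(1), which leaves room for the later factor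
    ln x - 1. *)
Lemma muid_sum_sigma : log_bounded 0 (fun x => act muid (act pa (act one one)) x
  - (zeta (1 - a) / zeta 2 * x + zeta b / b / zeta (2 + a) * x `^ b
     + act muid (Delta a) x)).
Proof.
have := log_boundedB (log_boundedD (log_boundedZ (zeta (1 - a)) muid_id)
  (log_boundedZ (zeta b / b) muid_powRb))
  (log_boundedZ (zeta (- a) / 2) (@log_bounded_muid_one R)).
apply: eq_log_bounded => x x1; have x0 : 0 <= x by rewrite (le_trans _ x1).
have -> : act muid (act pa (act one one)) x = zeta (1 - a) * act muid id x
    + zeta b / b * act muid (fun y => y `^ b) x - zeta (- a) / 2 * act muid one x
    + act muid (Delta a) x.
  rewrite -!actZ -actD -actB -actD; apply: act_ext => // y /andP[y1 _].
  by rewrite /Delta sum_sigmaE ?(le_trans _ y1)//; ring.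
ring.
Qed.

Lemma muid_sigma_log : log_bounded 1 (fun x => act muid (act pa (act one (@ln R))) x
  - (zeta (1 - a) / zeta 2 * x + zeta b / b ^+ 2 / zeta (2 + a) * x `^ b)).
Proof.
have h : log_bounded 0 (fun y => act pa (act one (@ln R)) y - (zeta (1 - a) * y
    + zeta b / b ^+ 2 * y `^ b + - (zeta (- a) / 2) * ln y)).
  by have := sigma_log_sum ha; apply: eq_log_bounded => x _; ring.
have := log_boundedD (muid_step h) (log_boundedZ (- (zeta (- a) / 2)) (@muid_ln R)).
by apply: eq_log_bounded => x _; rewrite actZ; ring.
Qed.

Lemma sum_id_pow_asymp : log_bounded 0 (fun x => act pa one x - b^-1 * x `^ b).
Proof.
have [||C CP] := @sum_powRN_zeta R (- a); first by rewrite oppr_gt0.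
  by rewrite lt_eqF//; case/andP: ha; lra.
have C0 : 0 <= C by have := le_trans (normr_ge0 _) (CP 1 (lexx _)); rewrite powR1 mulr1.
exists (C + `|zeta (- a)|) => x x1; rewrite expr0 mulr1.
have -> : act pa one x = sum_upto x (fun n => n%:R `^ (- - a)).
  by apply: eq_sum_upto => n _; rewrite mulr1 opprK.
rewrite (_ : _ - _ = sum_upto x (fun n => n%:R `^ (- - a))
   - x `^ (1 - - a) / (1 - - a) - zeta (- a) + zeta (- a)); last first.
  by rewrite subrK opprK [_ / _]mulrC.
rewrite (le_trans (ler_normD _ _))// lerD2r (le_trans (CP x x1))// opprK ler_piMr//.
by rewrite -(powRr0 x) ler_powR// ltW.
Qed.

(** Each piece of [stirling_weightE] has its own tool: [muid_lnid] for the logarithm, with Z = -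
    zeta'(2 + a), inversion for the constant ln sqrt(2 pi), and [act_stirling_rem] followed by
    [muid_step] for the remainder. *)
Lemma muid_stirling : exists Theta : R, 0 < Theta /\
  log_bounded 1 (fun x => act muid (act pa (act (@stirling_weight R) one)) x
    - (b^-1 * (- (derive1 (@zeta R) (2 + a) / 2) + Theta * zeta (3 + a)) / zeta (2 + a)
       + ln (Num.sqrt (2 * pi)) / b) * x `^ b).
Proof.
have s1 : 1 < 2 + a <= 2 by case/andP: ha; lra.
have [Z [C [cZ ZP]]] := sum_ln_powRN s1.
case/andP: s1 => s1 _.
have [Rb [Rb0 RbP]] := @act_stirling_rem R b b0.
have z3 : 0 < zeta (3 + a) by apply: zeta_gt0; move: s1; lra.
exists (Rb / zeta (3 + a)); split; first by rewrite divr_gt0.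
rewrite (derive1_zeta s1 cZ) divfK ?gt_eqF//.
have ZP' x : 1 <= x -> `|x `^ b * sum_upto x (fun n => ln n%:R * n%:R `^ (- (1 + b)))
    - (Z * x `^ b - ln x / b)| <= C.
  have e1 : 2 + a - 1 = b by ring.
  have e2 : 2 + a = 1 + b by ring.
  by move=> x1; have := ZP x x1; rewrite e1 e2.
have h1 := muid_lnid b0 ZP' sum_id_pow_asymp.
have h2 : log_bounded 0 (fun x => act (@stirling_rem R) (act pa one) x
    - (0 * x + b^-1 * Rb * x `^ b + (fun=> 0) x)).
  have := RbP _ _ sum_id_pow_asymp; apply: eq_log_bounded => x _; ring.
have h3 := muid_step h2.
have h4 := log_boundedW (leq0n 1) sum_id_pow_asymp.
have := log_boundedD (log_boundedD (log_boundedZ 2^-1 h1) h3)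
  (log_boundedZ (ln (Num.sqrt (2 * pi))) h4).
apply: eq_log_bounded => x x1; have x0 : 0 <= x by rewrite (le_trans _ x1).
have -> : act muid (act pa (act (@stirling_weight R) one)) x
    = 2^-1 * act muid (act (over_id lnn) (act pa one)) x
      + act muid (act (@stirling_rem R) (act pa one)) x
      + ln (Num.sqrt (2 * pi)) * act pa one x.
  rewrite -(act_moebius_idK (act pa one) x1) -!actZ -!actD.
  apply: act_ext => // y /andP[y1 _]; rewrite act_comm ?(le_trans _ y1)//.
  rewrite (act_eqc _ _ (@stirling_weightE R)) !act_addc !act_scalec; ring.
have -> : act muid (fun=> 0) x = 0.
  by rewrite /act sum_uptoE big1// => n _; rewrite mulr0.
rewrite (_ : 1 + b = 2 + a); last by ring.
have z2 := zeta_gt0 s1; have zz := @zeta_gt0 R 2 (ltr1n R 2).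
by field; rewrite !gt_eqF.
Qed.

Lemma Lsum_id_powE x : 1 <= x -> Lsum x (@id_pow R b) =
  (ln x - 1) * act muid (act pa (act one one)) x
  - act muid (act pa (act one (@ln R))) x
  + act muid (act pa (act (@stirling_weight R) one)) x.
Proof.
move=> x1; have x0 : 0 < x by rewrite (lt_le_trans _ x1).
rewrite (Lsum_act x0 (@moebius_inversion R (id_pow b))).
rewrite act_conv_over_id ?(ltW x0)// -actZ -actB -actD.
apply: act_ext; first exact: ltW.
move=> y _; rewrite (act_eqc (d := pa)); first by rewrite actD actB actZ.
move=> n n0; have nR : 0 < n%:R :> R by rewrite ltr0n.
by rewrite /over_id /id_pow powRD_gt0// powRr1 ?(ltW nR)// mulrAC divff ?gt_eqF// mul1r.
Qed.

(** The Jordan totient is already mu * id_b, so Moebius inversion brings in a second factor mu. *)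
Lemma Lsum_jordanE x : 1 <= x -> Lsum x (@jordan R b) =
  (ln x - 1) * act muid (act muid (act pa (act one one))) x
  - act muid (act muid (act pa (act one (@ln R)))) x
  + act muid (act muid (act pa (act (@stirling_weight R) one))) x.
Proof.
move=> x1; have x0 : 0 < x by rewrite (lt_le_trans _ x1).
rewrite (Lsum_act x0 (@moebius_inversion R (jordan b))).
rewrite act_conv_over_id ?(ltW x0)// -actZ -actB -actD.
apply: act_ext; first exact: ltW.
move=> y /andP[y1 _]; have y0 : 0 <= y by rewrite (le_trans _ y1).
rewrite act_conv_over_id// -actZ -actB -actD; apply: act_ext => // z _.
rewrite (act_eqc (d := pa)); first by rewrite actD actB actZ.
move=> n n0; have nR : 0 < n%:R :> R by rewrite ltr0n.
by rewrite /over_id /id_pow powRD_gt0// powRr1 ?(ltW nR)// mulrAC divff ?gt_eqF// mul1r.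
Qed.

(** For x >= e one has 1 + ln x <= 2 ln x. *)
Lemma log_bounded_near k F : log_bounded k F ->
  exists C : R, \forall x \near +oo_R, `|F x| <= C * ln x ^+ k.
Proof.
case/log_bounded_ge0=> C C0 CP; exists (C * 2 ^+ k); near=> x.
have xe : expR 1 <= x by near: x; exact: nbhs_pinfty_ge.
have x0 : 0 < x by rewrite (lt_le_trans (expR_gt0 1)).
have x1 : 1 <= x by rewrite (le_trans _ xe)// ltW// expR_gt1.
have l1 : 1 <= ln x by rewrite -[leLHS]expRK ler_ln ?posrE ?expR_gt0.
rewrite (le_trans (CP x x1))// -mulrA ler_wpM2l// -exprMn.
by rewrite lerXn2r// ?nnegrE; lra.
Unshelve. all: by end_near. Qed.

End Assembly.

(** * Combination of the three means into both expansions *)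

Theorem theorem5 (R : realType) (a : R) (ha : -1 < a < 0) :
  exists Theta : R, 0 < Theta /\
    (exists C : R, \forall x \near +oo_R,
      `|Lsum x (id_pow (1 + a))
        - (zeta (1 - a) / zeta 2 * x * ln x
           - 2 * zeta (1 - a) / zeta 2 * x
           + zeta (1 + a) / ((1 + a) * zeta (2 + a)) * x `^ (1 + a) * ln x
           - 1 / ((1 + a) * zeta (2 + a))
             * ((2 + a) * zeta (1 + a) / (1 + a)
                + derive1 (@zeta R) (2 + a) / 2
                - Theta * zeta (3 + a)) * x `^ (1 + a)
           + ln (Num.sqrt (2 * pi)) / (1 + a) * x `^ (1 + a)
           + sum_upto x (fun n => moebius n / n%:R * Delta a (x / n%:R))
             * ln (x / expR 1))| <= C * ln x) /\
    (exists C : R, \forall x \near +oo_R,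
      `|Lsum x (jordan (1 + a))
        - (zeta (1 - a) / zeta 2 ^+ 2 * x * ln x
           - 2 * zeta (1 - a) / zeta 2 ^+ 2 * x
           + zeta (1 + a) / ((1 + a) * zeta (2 + a) ^+ 2) * x `^ (1 + a) * ln x
           - 1 / ((1 + a) * zeta (2 + a) ^+ 2)
             * ((2 + a) * zeta (1 + a) / (1 + a)
                + derive1 (@zeta R) (2 + a) / 2
                - Theta * zeta (3 + a)) * x `^ (1 + a)
           + ln (Num.sqrt (2 * pi)) / ((1 + a) * zeta (2 + a)) * x `^ (1 + a)
           + sum_upto x (fun n => dirichlet_conv moebius moebius n / n%:R
                                  * Delta a (x / n%:R))
             * ln (x / expR 1))| <= C * ln x ^+ 3).
Proof.
have [th [th0 hP]] := muid_stirling ha.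
have b0 : 0 < 1 + a by case/andP: ha; lra.
have z2 : 0 < zeta 2 :> R := zeta_gt0 (ltr1n R 2).
have za : 0 < zeta (2 + a) by apply: zeta_gt0; lra.
have hD := muid_sum_sigma ha; have hT := muid_sigma_log ha.
have hl : log_bounded 1 (fun x : R => ln x - 1).
  exact: log_boundedB (log_bounded_ln R) (log_boundedW (leq0n 1) (log_bounded_cst 1)).
have lnE x : 1 <= x -> ln (x / expR 1) = ln x - 1 :> R.
  by move=> x1; rewrite ln_div ?posrE ?expR_gt0 ?expRK// (lt_le_trans _ x1).
exists th; split => //; split.
  suff : log_bounded 1 (fun x => Lsum x (id_pow (1 + a))
        - (zeta (1 - a) / zeta 2 * x * ln x
           - 2 * zeta (1 - a) / zeta 2 * x
           + zeta (1 + a) / ((1 + a) * zeta (2 + a)) * x `^ (1 + a) * ln x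
           - 1 / ((1 + a) * zeta (2 + a))
             * ((2 + a) * zeta (1 + a) / (1 + a)
                + derive1 (@zeta R) (2 + a) / 2
                - th * zeta (3 + a)) * x `^ (1 + a)
           + ln (Num.sqrt (2 * pi)) / (1 + a) * x `^ (1 + a)
           + sum_upto x (fun n => moebius n / n%:R * Delta a (x / n%:R))
             * ln (x / expR 1))).
    by case/log_bounded_near=> C; exists C.
  have := log_boundedD (log_boundedB (log_boundedM hl hD) hT) hP.
  apply: eq_log_bounded => x x1; rewrite Lsum_id_powE// lnE//.
  rewrite -[sum_upto _ _]/(act (over_id moebius) (Delta a) x).
  by field; rewrite !gt_eqF.
(* The zero function fills the slot [G] of [muid_step]. *)
have hT' : log_bounded 1 (fun x => act (over_id moebius) (act (id_pow a) (act (fun=> 1) (@ln R))) x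
    - (zeta (1 - a) / zeta 2 * x + zeta (1 + a) / (1 + a) ^+ 2 / zeta (2 + a) * x `^ (1 + a)
       + (fun=> 0) x)).
  by move: hT; apply: eq_log_bounded => x _; ring.
have hP' := log_bounded_muid hP.
suff : log_bounded 3 (fun x => Lsum x (jordan (1 + a))
        - (zeta (1 - a) / zeta 2 ^+ 2 * x * ln x
           - 2 * zeta (1 - a) / zeta 2 ^+ 2 * x
           + zeta (1 + a) / ((1 + a) * zeta (2 + a) ^+ 2) * x `^ (1 + a) * ln x
           - 1 / ((1 + a) * zeta (2 + a) ^+ 2)
             * ((2 + a) * zeta (1 + a) / (1 + a)
                + derive1 (@zeta R) (2 + a) / 2
                - th * zeta (3 + a)) * x `^ (1 + a)
           + ln (Num.sqrt (2 * pi)) / ((1 + a) * zeta (2 + a)) * x `^ (1 + a)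
           + sum_upto x (fun n => dirichlet_conv moebius moebius n / n%:R
                                  * Delta a (x / n%:R))
             * ln (x / expR 1))).
  by case/log_bounded_near=> C; exists C.
(* Every error below is of order at most (log x)^2, within the stated cube. *)
apply: (@log_boundedW _ 2) => //.
set kap := (_ * _ / _ + _) in hP hP'.
have := log_boundedD (log_boundedB (log_boundedM hl (muid_step ha hD)) (muid_step ha hT'))
   (log_boundedD hP' (log_boundedZ kap (log_boundedW (leq0n 2) (muid_powRb ha)))).
apply: eq_log_bounded => x x1; have x0 : 0 <= x by rewrite (le_trans _ x1).
rewrite Lsum_jordanE// lnE//.
rewrite -[sum_upto _ _]/(act (over_id (dirichlet_conv moebius moebius)) (Delta a) x).
rewrite act_conv_over_id// actB actZ.
have -> : act (over_id moebius) (fun=> 0) x = 0 :> R.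
  by rewrite /act sum_uptoE big1// => n _; rewrite mulr0.
by rewrite /kap; field; rewrite !gt_eqF.
Qed.
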